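(* Let $n\ge1$ and let $\mathcal{S}_0^n$ be the initial seed constructed by Kang–Kashiwara–Kim–Oh for the category $R\text{-}gmod$ associated with a Lie algebra of type $A_n$, whose cluster variables are the classes of the modules $M(1,0),\ldots,M(r_n,0)$, $r_n=n(n+1)/2$. Then the cluster variables of $\mathcal{S}_0^n$ are described in terms of dominant words by the following triangular array (read row by row, the $l$-th entry of the $k$-th row being the class of $M(k(k-1)/2+l,0)$): $$\begin{array}{ccccc} [L(1)] \\ [L(12)] & [L((2)(1))] \\ [L(123)] & [L((23)(12))] & [L((3)(2)(1))] \\ \vdots & \vdots \\ [L(1\ldots k)] & [L((2\ldots k)(1\ldots k-1))] & \cdots & [L((k)\cdots(1))] \\ \vdots & \vdots \\ [L(1\ldots n)] & [L((2\ldots n)(1\ldots n-1))] & \cdots & \cdots & [L((n)\cdots(1))] \end{array}$$ that is, for $1\le l\le k\le n$ the $l$-th entry of row $k$ is $[L(\mu)]$ with $\mu=(l\ldots k)(l-1\ldots k-1)\cdots(1\ldots k-l+1)$ (classes are understood up to grading shift). The set of frozen variables corresponds to the last line, and the set of unfrozen variables is the union of lines $1,\ldots,n-1$.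
   Context: Let $\mathbf{k}$ be a field and $\mathfrak{g}$ of type $A_n$, with simple roots $\alpha_1,\ldots,\alpha_n$, $(\alpha_i,\alpha_i)=2$, $(\alpha_i,\alpha_{i\pm1})=-1$, $(\alpha_i,\alpha_j)=0$ otherwise, fundamental weights $\omega_1,\ldots,\omega_n$, simple reflections $s_1,\ldots,s_n$, and $Q_+=\bigoplus_i\mathbb{Z}_{\ge0}\alpha_i$. For $\beta=\sum_i m_i\alpha_i\in Q_+$ of length $m=\sum m_i$, $Seq(\beta)$ is the set of words $\nu=\nu_1\cdots\nu_m$ in the letters $1,\ldots,n$ with $m_i$ occurrences of each $i$. Set $Q_{i,i}=0$, $Q_{i,i+1}(u,v)=u-v$, $Q_{i,i-1}(u,v)=v-u$, and $Q_{i,j}=1$ otherwise. The quiver Hecke algebra $R(\beta)$ is the $\mathbf{k}$-algebra generated by $e(\nu)$ ($\nu\in Seq(\beta)$), $x_1,\ldots,x_m$, $\tau_1,\ldots,\tau_{m-1}$ with relations: $e(\nu)e(\nu')=\delta_{\nu,\nu'}e(\nu)$; $\sum_\nu e(\nu)=1$; $x_ix_j=x_jx_i$; $x_ie(\nu)=e(\nu)x_i$; $\tau_ke(\nu)=e(s_k\nu)\tau_k$; $\tau_k\tau_l=\tau_l\tau_k$ if $|k-l|>1$; $\tau_k^2e(\nu)=Q_{\nu_k,\nu_{k+1}}(x_k,x_{k+1})e(\nu)$; $(\tau_kx_i-x_{s_k(i)}\tau_k)e(\nu)$ equals $-e(\nu)$ if $i=k$ and $\nu_k=\nu_{k+1}$,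 equals $e(\nu)$ if $i=k+1$ and $\nu_k=\nu_{k+1}$, and equals $0$ otherwise; $(\tau_{k+1}\tau_k\tau_{k+1}-\tau_k\tau_{k+1}\tau_k)e(\nu)$ equals $\frac{Q_{\nu_k,\nu_{k+1}}(x_k,x_{k+1})-Q_{\nu_k,\nu_{k+1}}(x_{k+2},x_{k+1})}{x_k-x_{k+2}}e(\nu)$ if $\nu_k=\nu_{k+2}$ and $0$ otherwise. It is $\mathbb{Z}$-graded by $\deg e(\nu)=0$, $\deg x_ke(\nu)=2$, $\deg\tau_ke(\nu)=-(\alpha_{\nu_k},\alpha_{\nu_{k+1}})$. $R\text{-}gmod=\bigoplus_{\beta\in Q_+}R(\beta)\text{-}gmod$, where $R(\beta)\text{-}gmod$ is the category of finite-dimensional graded left $R(\beta)$-modules. Words in $\{1<\cdots<n\}$ are totally ordered lexicographically (a proper prefix is smaller). A word is Lyndon if it is smaller than all its proper right factors; every word is uniquely a concatenation of Lyndon words in weakly decreasing order (canonical factorization). In type $A_n$ the dominant words are the words all of whose canonical Lyndon factors have the form $(k\ldots l)=(k,k+1,\ldots,l)$, $1\le k\le l\le n$. For each dominant word $\mu$ there is a simple object $L(\mu)$ of $R\text{-}gmod$, unique up to isomorphism and grading shift, such that $\mu$ is the highest word $\nu$ with $e(\nu)L(\mu)\ne0$, and every simple object is of this form up to shift for a unique $\mu$. The seed $\mathcal{S}_0^n$. Let $(i_1,\ldots,i_{r_n})=(1,\,2,1,\,3,2,1,\ldots,\,n,n-1,\ldots,1)$, so $w_0=s_{i_1}\cdots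 s_{i_{r_n}}$ is a reduced expression of the longest element of the Weyl group. For $1\le s\le r_n$ set $\lambda_s=s_{i_1}\cdots s_{i_s}\omega_{i_s}$. The determinantial module $M(s,0)=M(\lambda_s,\omega_{i_s})$ is the (real, self-dual) simple module in $R(\omega_{i_s}-\lambda_s)\text{-}gmod$ whose graded character is the unipotent quantum minor $D(\lambda_s,\omega_{i_s})$. Here $D(\lambda_s,\omega_{i_s})$ is the linear form $x\mapsto(u_{\omega_{i_s}},x\,u_{\lambda_s})$ on $U_q^+(\mathfrak{g})$, with $u_{\omega_{i_s}},u_{\lambda_s}$ the extremal weight vectors of the irreducible $U_q(\mathfrak{g})$-module $V(\omega_{i_s})$ and $(\cdot,\cdot)$ its standard symmetric form, and the correspondence with modules is: the graded dimension of $e(\nu)M(s,0)$ is $D(\lambda_s,\omega_{i_s})(e_{\nu_m}\cdots e_{\nu_1})$ for every word $\nu=\nu_1\cdots\nu_m$, where the $e_i$ are the Chevalley generators of $U_q^+(\mathfrak{g})$. This determines $M(s,0)$ up to isomorphism. For $1\le s\le r_n$ put $s_+=\min(\{t\mid s<t\le r_n,\ i_t=i_s\}\cup\{r_n+1\})$. The cluster variables of $\mathcal{S}_0^n$ are the classes $[M(s,0)]$, $1\le s\le r_n$; the variable $[M(s,0)]$ is frozen if $s_+=r_n+1$ and unfrozen otherwise. *)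

(* Defs.v *)
From HB Require Import structures.
From mathcomp Require Import all_boot all_order all_algebra perm.
From mathcomp Require Import monalg boolp.

Set Implicit Arguments.
Unset Strict Implicit.
Unset Printing Implicit Defensive.

Import Order.TTheory GRing.Theory Num.Theory.

Local Open Scope ring_scope.
Local Open Scope quotient_scope.

(* A relation [lhs = rhs] is a pair, and a set of relations is a predicate
   [S lhs rhs]; the two-sided ideal is generated by the [lhs - rhs]. *)
Section RelationQuotient.
Variables (k : fieldType) (A : lalgType k) (S : A -> A -> Prop).

Inductive in_ideal : A -> Prop :=
| In_ideal0 : in_ideal 0
| In_idealD x y : in_ideal x -> in_ideal y -> in_ideal (x + y)
| In_idealS a b lhs rhs : S lhs rhs -> in_ideal (a * (lhs - rhs) * b).

Definition ideal_pred : {pred A} := fun x => `[< in_ideal x >].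

Lemma in_idealMl a x : in_ideal x -> in_ideal (a * x).
Proof.
elim=> [|u v _ hu _ hv|b c l r h]; first by rewrite mulr0; constructor.
  by rewrite mulrDr; constructor.
by rewrite mulrA mulrA; constructor.
Qed.

Lemma in_idealMr a x : in_ideal x -> in_ideal (x * a).
Proof.
elim=> [|u v _ hu _ hv|b c l r h]; first by rewrite mul0r; constructor.
  by rewrite mulrDl; constructor.
by rewrite -mulrA; constructor.
Qed.

Lemma ideal_zmod_closed : zmod_closed ideal_pred.
Proof.
split; first by apply/asboolP; constructor.
move=> x y /asboolP hx /asboolP hy; apply/asboolP; constructor=> //.
by rewrite -mulN1r; apply: in_idealMl.
Qed.

HB.instance Definition _ :=
  GRing.isZmodClosed.Build A ideal_pred ideal_zmod_closed.

Definition relquot : Type := Quotient.quot ideal_pred.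

HB.instance Definition _ := GRing.Zmodule.on relquot.
HB.instance Definition _ := EqQuotient.on relquot.
HB.instance Definition _ := ZmodQuotient.on relquot.

Definition to_quot (x : A) : relquot := \pi x.

Lemma to_quotP x y : to_quot x = to_quot y <-> in_ideal (x - y).
Proof.
rewrite /to_quot; split=> [/eqP|h].
  by rewrite -Quotient.idealrBE => /asboolP.
by apply/eqP; rewrite -Quotient.idealrBE; apply/asboolP.
Qed.

Lemma to_quot_repr (u : relquot) : to_quot (repr u) = u.
Proof. exact: reprK. Qed.

Lemma to_quotD x y : to_quot (x + y) = to_quot x + to_quot y.
Proof. by rewrite /to_quot !piE. Qed.

Definition quot_one : relquot := to_quot 1.
Definition quot_mul (u v : relquot) : relquot := to_quot (repr u * repr v).
Definition quot_scale (c : k) (u : relquot) : relquot := to_quot (c *: repr u).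

Lemma to_quotM x y : quot_mul (to_quot x) (to_quot y) = to_quot (x * y).
Proof.
apply/to_quotP; set x' := repr _; set y' := repr _.
have -> : x' * y' - x * y = (x' - x) * y' + x * (y' - y).
  by rewrite mulrBl mulrBr addrA subrK.
constructor; [apply: in_idealMr | apply: in_idealMl];
  by apply/to_quotP; rewrite to_quot_repr.
Qed.

Lemma to_quotZ c x : quot_scale c (to_quot x) = to_quot (c *: x).
Proof.
apply/to_quotP; rewrite -scalerBr -[_ - _]mul1r scalerAl.
by apply: in_idealMl; apply/to_quotP; rewrite to_quot_repr.
Qed.

Lemma quot_mulA : associative quot_mul.
Proof.
move=> u v w; rewrite -(to_quot_repr u) -(to_quot_repr v) -(to_quot_repr w).
by rewrite !to_quotM mulrA.
Qed.

Lemma quot_mul1 : left_id quot_one quot_mul.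
Proof. by move=> u; rewrite -(to_quot_repr u) to_quotM mul1r. Qed.

Lemma quot_mulr1 : right_id quot_one quot_mul.
Proof. by move=> u; rewrite -(to_quot_repr u) to_quotM mulr1. Qed.

Lemma quot_mulDl : left_distributive quot_mul +%R.
Proof.
move=> u v w; rewrite -(to_quot_repr u) -(to_quot_repr v) -(to_quot_repr w).
by rewrite -to_quotD !to_quotM -to_quotD mulrDl.
Qed.

Lemma quot_mulDr : right_distributive quot_mul +%R.
Proof.
move=> u v w; rewrite -(to_quot_repr u) -(to_quot_repr v) -(to_quot_repr w).
by rewrite -to_quotD !to_quotM -to_quotD mulrDr.
Qed.

(* Only a [pzRingType], hence no [lalgType]: the quotient may be zero. *)
HB.instance Definition _ := GRing.Zmodule_isPzRing.Build relquot
  quot_mulA quot_mul1 quot_mulr1 quot_mulDl quot_mulDr.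

Lemma quot_scaleA a b u :
  quot_scale a (quot_scale b u) = quot_scale (a * b) u.
Proof. by rewrite -(to_quot_repr u) !to_quotZ scalerA. Qed.

Lemma quot_scale1 : left_id 1 quot_scale.
Proof. by move=> u; rewrite -(to_quot_repr u) to_quotZ scale1r. Qed.

Lemma quot_scaleDr : right_distributive quot_scale +%R.
Proof.
move=> c u v; rewrite -(to_quot_repr u) -(to_quot_repr v).
by rewrite -to_quotD !to_quotZ -to_quotD scalerDr.
Qed.

Lemma quot_scaleDl u : {morph quot_scale^~ u : a b / a + b}.
Proof.
by move=> a b; rewrite -(to_quot_repr u) !to_quotZ -to_quotD scalerDl.
Qed.

HB.instance Definition _ := GRing.Zmodule_isLmodule.Build k relquot
  quot_scaleA quot_scale1 quot_scaleDr quot_scaleDl.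

End RelationQuotient.

Definition free_alg (k : fieldType) (G : choiceType) : lalgType k :=
  {malg k[{fmonom G}]}.

Definition free_gen (k : fieldType) (G : choiceType) (g : G) : free_alg k G :=
  mkmalgU (fmu g) 1.

Section Modules.
Variables (k : fieldType) (A : lalgType k) (S : A -> A -> Prop).
Local Notation R := (relquot S).

Record fdmod := FdMod {
  carrier :> vectType k;
  act : R -> 'End(carrier);
  act1 : act 1 = \1%VF;
  actM : forall a b, act (a * b) = (act a \o act b)%VF;
  actD : forall a b, act (a + b) = act a + act b;
  actZ : forall (c : k) a, act (c *: a) = c *: act a
}.

Definition submodule (M : fdmod) (U : {vspace M}) : Prop :=
  forall a, (act M a @: U <= U)%VS.

Definition irreducible (M : fdmod) : Prop :=
  (fullv : {vspace M}) <> 0%VS /\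
  forall U : {vspace M}, submodule U -> U = 0%VS \/ U = fullv.

End Modules.

(* The letter i : 'I_n stands for the vertex i.+1 of the Dynkin diagram. A
   weight is given by its coordinates on the fundamental weights, so that
   lam i = <h_i, lam>. *)

Definition cartan (n : nat) (i j : 'I_n) : int :=
  if i == j then 2 else
  if (i.+1 == j :> nat) || (j.+1 == i :> nat) then -1 else 0.

Definition weight (n : nat) := {ffun 'I_n -> int}.

Definition omega (n : nat) (i : 'I_n) : weight n :=
  [ffun j => (i == j)%:Z].

Definition alpha (n : nat) (i : 'I_n) : weight n :=
  [ffun j => cartan j i].

Definition refl (n : nat) (i : 'I_n) (lam : weight n) : weight n :=
  lam - alpha i *~ lam i.

Definition weyl (n : nat) (w : seq 'I_n) (lam : weight n) : weight n :=
  foldr (@refl n) lam w.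

Definition Qplus (n : nat) := {ffun 'I_n -> nat}.

Definition qwt (n : nat) (beta : Qplus n) : weight n :=
  \sum_i alpha i *+ beta i.

Definition ht (n : nat) (beta : Qplus n) : nat := (\sum_i beta i)%N.

Definition content (n : nat) (w : seq 'I_n) : Qplus n :=
  [ffun i => count_mem i w].

Section Words.
Variable n : nat.
Implicit Types u v w : seq 'I_n.

Definition word_le u v : bool := ((u : seqlexi 'I_n) <= v)%O.
Definition word_lt u v : bool := ((u : seqlexi 'I_n) < v)%O.

Definition lyndon w : Prop :=
  w <> [::] /\
  forall u v, w = u ++ v -> u <> [::] -> v <> [::] -> word_lt w v.

Definition canonical_factorization (ws : seq (seq 'I_n)) w : Prop :=
  [/\ flatten ws = w, forall x, x \in ws -> lyndon x
    & sorted (fun u v => word_le v u) ws].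

(* (a, a+1, ..., b) for 1 <= a <= b <= n, in the letters 1, ..., n. *)
Definition segment (a b : nat) : seq 'I_n :=
  [seq i : 'I_n <- enum 'I_n | (a <= i.+1 <= b)%N].

Definition dominant w : Prop :=
  exists2 ws, canonical_factorization ws w
    & forall x, x \in ws ->
        exists a b, (1 <= a <= b)%N /\ (b <= n)%N /\ x = segment a b.

(* (l ... r)(l-1 ... r-1) ... (1 ... r-l+1) *)
Definition array_word (r l : nat) : seq 'I_n :=
  flatten [seq segment (l - j) (r - j) | j <- iota 0 l].

End Words.

Section QuiverHecke.
Variables (k : fieldType) (n : nat).

Definition Qpol (B : pzRingType) (i j : 'I_n) (u v : B) : B :=
  if i == j then 0 else
  if j == i.+1 :> nat then u - v else
  if i == j.+1 :> nat then v - u else 1.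

(* The divided difference (Q_ij(u,v) - Q_ij(w,v)) / (u - w), a constant here. *)
Definition Qdiv (i j : 'I_n) : int :=
  if j == i.+1 :> nat then 1 else
  if i == j.+1 :> nat then -1 else 0.

Lemma QdivP (B : comPzRingType) (i j : 'I_n) (u v w : B) :
  Qpol i j u v - Qpol i j w v = (Qdiv i j)%:~R * (u - w).
Proof.
rewrite /Qpol /Qdiv; case: (i =P j) => [->|_].
  by rewrite ltn_eqF ?ltnSn // subrr mul0r.
case: ifP => _; first by rewrite mul1r opprB addrA subrK.
case: ifP => _; last by rewrite subrr mul0r.
by rewrite mulN1r opprB opprB addrC addrA subrK.
Qed.

Variable beta : Qplus n.
Local Notation m := (ht beta).

Definition Seq := {nu : m.-tuple 'I_n | [forall i, count_mem i nu == beta i]}.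

Definition letter (nu : Seq) (a : 'I_m) : 'I_n := tnth (val nu) a.

(* For c : 'I_m.-1 standing for the index c.+1 of tau, the two consecutive
   positions that it exchanges. *)
Definition lo (c : 'I_m.-1) : 'I_m := widen_ord (leq_pred m) c.

Lemma hi_subproof (c : 'I_m.-1) : (c.+1 < m)%N.
Proof. by case: c => c /=; case: m. Qed.

Definition hi (c : 'I_m.-1) : 'I_m := Ordinal (hi_subproof c).

Definition sw (c : 'I_m.-1) : {perm 'I_m} := tperm (lo c) (hi c).

Lemma seq_swap_subproof (c : 'I_m.-1) (nu : Seq) :
  [forall i, count_mem i [tuple letter nu (sw c a) | a < m] == beta i].
Proof.
apply/forallP=> i; have /forallP/(_ i)/eqP <- := valP nu.
apply/eqP; apply/seq.permP; apply/tuple_permP.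
by exists (sw c).
Qed.

Definition seq_swap (c : 'I_m.-1) (nu : Seq) : Seq :=
  exist _ [tuple letter nu (sw c a) | a < m] (seq_swap_subproof c nu).

Definition qh_gen : choiceType := (Seq + 'I_m + 'I_m.-1)%type.
Definition qh_free := free_alg k qh_gen.
Definition fe (nu : Seq) : qh_free := free_gen k (inl (inl nu) : qh_gen).
Definition fx (a : 'I_m) : qh_free := free_gen k (inl (inr a) : qh_gen).
Definition ft (c : 'I_m.-1) : qh_free := free_gen k (inr c : qh_gen).

Inductive qh_rel : qh_free -> qh_free -> Prop :=
| qh_ee nu nu' : qh_rel (fe nu * fe nu') (if nu == nu' then fe nu else 0)
| qh_sum1 : qh_rel (\sum_(nu : Seq) fe nu) 1
| qh_xx a b : qh_rel (fx a * fx b) (fx b * fx a)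
| qh_xe a nu : qh_rel (fx a * fe nu) (fe nu * fx a)
| qh_te c nu : qh_rel (ft c * fe nu) (fe (seq_swap c nu) * ft c)
| qh_tt (c d : 'I_m.-1) : (c.+1 < d)%N || (d.+1 < c)%N ->
    qh_rel (ft c * ft d) (ft d * ft c)
| qh_tsq c nu :
    qh_rel (ft c ^+ 2 * fe nu)
           (Qpol (letter nu (lo c)) (letter nu (hi c)) (fx (lo c)) (fx (hi c))
              * fe nu)
| qh_tx c a nu :
    qh_rel ((ft c * fx a - fx (sw c a) * ft c) * fe nu)
           (if letter nu (lo c) == letter nu (hi c) then
              if a == lo c then - fe nu else
              if a == hi c then fe nu else 0
            else 0)
| qh_braid (c d : 'I_m.-1) nu : d = c.+1 :> nat ->
    qh_rel ((ft d * ft c * ft d - ft c * ft d * ft c) * fe nu)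
           (if letter nu (lo c) == letter nu (hi d) then
              (Qdiv (letter nu (lo c)) (letter nu (hi c)))%:~R * fe nu
            else 0).

Definition qh_alg := relquot qh_rel.

Definition qe (nu : Seq) : qh_alg := to_quot qh_rel (fe nu).
Definition qx (a : 'I_m) : qh_alg := to_quot qh_rel (fx a).
Definition qt (c : 'I_m.-1) : qh_alg := to_quot qh_rel (ft c).

(* The grading spanned by the products of the generators cut by idempotents:
   [x] and [tau] alone are sums over [nu] of such elements. *)
Inductive homog : int -> qh_alg -> Prop :=
| homog_e nu : homog 0 (qe nu)
| homog_x a nu : homog 2 (qx a * qe nu)
| homog_t c nu :
    homog (- cartan (letter nu (lo c)) (letter nu (hi c))) (qt c * qe nu)
| homog_0 d : homog d 0
| homog_D d a b : homog d a -> homog d b -> homog d (a + b)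
| homog_Z d (c : k) a : homog d a -> homog d (c *: a)
| homog_M d d' a b : homog d a -> homog d' b -> homog (d + d') (a * b).

Record gmod := GMod {
  umod :> fdmod qh_rel;
  gcomp : int -> {vspace umod};
  (* any finite set of degrees outside which the components vanish *)
  gsupp : seq int;
  gsupp_uniq : uniq gsupp;
  gsuppP : forall d, d \notin gsupp -> gcomp d = 0%VS;
  gdirect : directv (\sum_(d <- gsupp) gcomp d);
  gfull : (\sum_(d <- gsupp) gcomp d)%VS = fullv;
  gact : forall d d' a, homog d a -> (act umod a @: gcomp d' <= gcomp (d + d'))%VS
}.

Definition gsubmodule (M : gmod) (U : {vspace M}) : Prop :=
  submodule U /\ U = (\sum_(d <- gsupp M) (U :&: gcomp M d))%VS.

Definition simple (M : gmod) : Prop :=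
  (fullv : {vspace M}) <> 0%VS /\
  forall U : {vspace M}, gsubmodule U -> U = 0%VS \/ U = fullv.

Definition iso_shift (M L : gmod) : Prop :=
  exists (s : int) (f : 'Hom(M, L)),
    [/\ lker f = 0%VS, limg f = fullv,
        forall a, (f \o act M a = act L a \o f)%VF
      & forall d, (f @: gcomp M d)%VS = gcomp L (d + s)].

Definition highest_word (M : gmod) (mu : seq 'I_n) : Prop :=
  (exists2 nu : Seq, val nu = mu :> seq 'I_n & act M (qe nu) <> 0) /\
  forall nu : Seq, act M (qe nu) <> 0 -> word_le (val nu) mu.

(* For dominant mu this characterizes L(mu) up to isomorphism and grading
   shift. *)
Definition is_L (mu : seq 'I_n) (M : gmod) : Prop :=
  simple M /\ highest_word M mu.

End QuiverHecke.

Definition Qq : fieldType := {fraction {poly rat}}.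
Definition q : Qq := tofrac 'X.

Definition qint (m : nat) : Qq := (q ^+ m - q ^- m) / (q - q^-1).
Definition qfact (m : nat) : Qq := \prod_(j < m) qint j.+1.

Section QuantumGroup.
Variable n : nat.

(* An element h = \sum_i h_i alpha_i^vee of the coroot lattice. *)
Definition coroot := {ffun 'I_n -> int}.
Definition pairing (h : coroot) (lam : weight n) : int := \sum_i h i * lam i.
Definition hcoroot (i : 'I_n) : coroot := [ffun j => (i == j)%:Z].

Definition uq_gen : choiceType := ('I_n + 'I_n + coroot)%type.
Definition uq_free := free_alg Qq uq_gen.
Definition fE (i : 'I_n) : uq_free := free_gen Qq (inl (inl i) : uq_gen).
Definition fF (i : 'I_n) : uq_free := free_gen Qq (inl (inr i) : uq_gen).
Definition fK (h : coroot) : uq_free := free_gen Qq (inr h : uq_gen).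

(* fK h stands for q^h. *)
Inductive uq_rel : uq_free -> uq_free -> Prop :=
| uq_K0 : uq_rel (fK 0) 1
| uq_KK h h' : uq_rel (fK h * fK h') (fK (h + h'))
| uq_KE h i : uq_rel (fK h * fE i * fK (- h)) (q ^ pairing h (alpha i) *: fE i)
| uq_KF h i :
    uq_rel (fK h * fF i * fK (- h)) (q ^ (- pairing h (alpha i)) *: fF i)
| uq_EF i j :
    uq_rel (fE i * fF j - fF j * fE i)
           (if i == j then
              (q - q^-1)^-1 *: (fK (hcoroot i) - fK (- hcoroot i))
            else 0)
| uq_EE i j : i != j -> cartan i j = 0 -> uq_rel (fE i * fE j) (fE j * fE i)
| uq_FF i j : i != j -> cartan i j = 0 -> uq_rel (fF i * fF j) (fF j * fF i)
| uq_serreE i j : cartan i j = -1 ->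
    uq_rel (fE i ^+ 2 * fE j - (q + q^-1) *: (fE i * fE j * fE i)
            + fE j * fE i ^+ 2) 0
| uq_serreF i j : cartan i j = -1 ->
    uq_rel (fF i ^+ 2 * fF j - (q + q^-1) *: (fF i * fF j * fF i)
            + fF j * fF i ^+ 2) 0.

Definition uq_alg := relquot uq_rel.

Definition uE (i : 'I_n) : uq_alg := to_quot uq_rel (fE i).
Definition uF (i : 'I_n) : uq_alg := to_quot uq_rel (fF i).
Definition uK (h : coroot) : uq_alg := to_quot uq_rel (fK h).

(* The irreducible module V(lam), lam dominant, with its highest weight vector
   and its standard symmetric form. *)
Record hwmod (lam : weight n) := HwMod {
  hw_mod :> fdmod uq_rel;
  hw_irr : irreducible hw_mod;
  hwv : hw_mod;
  hwv_neq0 : hwv <> 0;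
  hwvE : forall i, act hw_mod (uE i) hwv = 0;
  hwvK : forall h, act hw_mod (uK h) hwv = q ^ pairing h lam *: hwv;
  form : hw_mod -> hw_mod -> Qq;
  form_sym : forall v w, form v w = form w v;
  form_lin : forall (c : Qq) u v w, form (c *: u + v) w = c * form u w + form v w;
  form_hwv : form hwv hwv = 1;
  formE : forall i v w, form (act hw_mod (uE i) v) w = form v (act hw_mod (uF i) w);
  formK : forall h v w, form (act hw_mod (uK h) v) w = form v (act hw_mod (uK h) w)
}.

(* u_{s_i mu} is f_i^(<h_i,mu>) u_mu or e_i^(-<h_i,mu>) u_mu, according to the
   sign of <h_i,mu>. *)
Fixpoint extremal (lam : weight n) (V : hwmod lam) (w : seq 'I_n) : V :=
  if w is i :: w' then
    let p := weyl w' lam i in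
    let x := if 0 <= p then uF i else uE i in
    (qfact `|p|%N)^-1 *: act V (x ^+ `|p|%N) (extremal V w')
  else hwv V.

(* D(w lam, lam), extended from U_q^+ to the whole of U_q. *)
Definition minor (lam : weight n) (V : hwmod lam) (w : seq 'I_n) (x : uq_alg) :
  Qq := form (hwv V) (act V x (extremal V w)).

End QuantumGroup.

Section Seed.
Variable n : nat.

Definition rn : nat := ((n * n.+1)./2)%N.

(* (1, 2,1, 3,2,1, ..., n,n-1,...,1) *)
Definition w0_seq : seq 'I_n :=
  flatten [seq rev (segment n 1 r) | r <- iota 1 n].

Lemma size_w0_seq : size w0_seq == rn.
Proof.
rewrite size_flatten /shape -map_comp /rn.
have E r : r \in iota 1 n -> size (rev (segment n 1 r)) = r.
  rewrite mem_iota add1n ltnS => /andP[_ rn].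
  rewrite size_rev size_filter -(count_map val (fun i => 0 < i.+1 <= r)%N).
  rewrite val_enum_ord -size_filter -[RHS](size_iota 0 r).
  rewrite -{1}(subnKC rn) iotaD filter_cat add0n.
  rewrite (@eq_in_filter _ _ predT) ?filter_predT; last first.
    by move=> i; rewrite mem_iota.
  rewrite (@eq_in_filter _ _ pred0) ?filter_pred0 ?cats0 //.
  by move=> i; rewrite mem_iota => /andP[]; rewrite leqNgt => /negbTE.
have -> : [seq (size \o (fun r => rev (segment n 1 r))) i | i <- iota 1 n]
        = iota 1 n.
  by rewrite -[RHS]map_id; apply/eq_in_map=> r /E.
elim: (n) => [//|p IH]; rewrite -{1}(addn1 p) iotaD sumn_cat (eqP IH) [sumn (iota _ 1)]/=.
have -> : (p.+1 * p.+2 = p * p.+1 + p.+1.*2)%N.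
  by rewrite -muln2 (mulnC p) -mulnDr addn2.
by rewrite halfD odd_double andbF doubleK add0n addn0 add1n.
Qed.

(* s : 'I_rn stands for the 1-based index s.+1. *)
Definition w0_word : rn.-tuple 'I_n := Tuple size_w0_seq.

Definition i_ (s : 'I_rn) : 'I_n := tnth w0_word s.

Definition prefix_ (s : 'I_rn) : seq 'I_n := take s.+1 w0_word.

Definition lambda_ (s : 'I_rn) : weight n := weyl (prefix_ s) (omega (i_ s)).

Definition s_plus (s : 'I_rn) : nat :=
  \big[minn/rn.+1]_(t < rn | (s < t)%N && (i_ t == i_ s)) t.+1.

Definition frozen (s : 'I_rn) : Prop := s_plus s = rn.+1.

Variable k : fieldType.

(* e(nu) has degree 0, so (e(nu)M)_d = e(nu)M_d. *)
Definition gdim (beta : Qplus n) (M : gmod k beta) (nu : Seq beta) : Qq :=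
  \sum_(d <- gsupp M) (\dim (act M (qe k nu) @: gcomp M d))%:R * q ^ d.

(* M is isomorphic to M(s,0), defined with the given models of the fundamental
   representations. *)
Definition is_M (V : forall i : 'I_n, hwmod (omega i)) (s : 'I_rn)
    (beta : Qplus n) (M : gmod k beta) : Prop :=
  [/\ qwt beta = omega (i_ s) - lambda_ s, simple M
    & forall nu : Seq beta,
        gdim M nu =
        minor (V (i_ s)) (prefix_ s) (\prod_(i <- rev (val nu)) uE i)].

End Seed.

(* Main.v *)
(* The fundamental representations are minuscule: V(omega_i) has a basis indexed
   by the i-element subsets of {0, ..., n}, on which e_a and f_a exchange a and
   a+1.  Hence the minor D(lambda_s, omega_{i_s}) takes on a product of e_i's the
   value 1 or 0, according to whether the word moves the subset of lambda_s down
   to the highest one.  For the l-th entry of row r this subset is {l, ..., r},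
   and in mu = (l..r)(l-1..r-1)... each letter is the largest one that can be
   applied, so mu is the highest word of M(s,0).

   It remains to see that a simple module is determined up to shift by its
   highest word mu.  Its mu-weight space contains a vector v killed by all x_a,
   and by the tau_c at an ascent of mu, since these raise the word.  Modulo
   shorter tau-words, braid moves bring a tau-word to a form that exhibits the
   strand arriving first.  That strand cannot come from an ascent of mu, and a
   strand starting a block of mu carries a letter that occurs nowhere before it.
   So e(mu) R v is the line spanned by v, with scalars that do not depend on the
   module, and the submodule of M + L generated by the two vectors v is the graph
   of an isomorphism. *)
Require Import Defs.
From HB Require Import structures.
From mathcomp Require Import all_boot all_order all_algebra perm.
From mathcomp Require Import finmap monalg boolp.
From mathcomp Require Import zify.

Set Implicit Arguments.
Unset Strict Implicit.
Unset Printing Implicit Defensive.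

Import Order.TTheory GRing.Theory Num.Theory.
Local Open Scope ring_scope.

(** * Quotient algebras and their modules *)

Section RelQuot.
Variables (k : fieldType) (A : lalgType k) (S : A -> A -> Prop).

Lemma to_quot_rel lhs rhs : S lhs rhs -> to_quot S lhs = to_quot S rhs.
Proof.
move=> h; apply/to_quotP; rewrite -[_ - _]mul1r -[_ * _]mulr1.
exact: In_idealS.
Qed.

Lemma quotM x y : to_quot S x * to_quot S y = to_quot S (x * y).
Proof. exact: to_quotM. Qed.

Lemma quotZ c x : c *: to_quot S x = to_quot S (c *: x).
Proof. exact: to_quotZ. Qed.

Lemma quotN x : - to_quot S x = to_quot S (- x).
Proof. by rewrite -scaleN1r quotZ scaleN1r. Qed.

Lemma quotB x y : to_quot S x - to_quot S y = to_quot S (x - y).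
Proof. by rewrite quotN -to_quotD. Qed.

Lemma quot0 : to_quot S 0 = 0.
Proof. by rewrite -(subrr (0 : A)) -quotB subrr. Qed.

Lemma quot1 : to_quot S 1 = 1.
Proof. by []. Qed.

Lemma quot_sum (I : Type) (r : seq I) (P : pred I) (F : I -> A) :
  to_quot S (\sum_(i <- r | P i) F i) = \sum_(i <- r | P i) to_quot S (F i).
Proof. by apply: (big_morph _ (@to_quotD _ _ S) quot0). Qed.

Lemma relquot_scaleAl c (a b : relquot S) : c *: (a * b) = (c *: a) * b.
Proof.
rewrite -(to_quot_repr a) -(to_quot_repr b).
by rewrite quotM !quotZ quotM scalerAl.
Qed.

End RelQuot.

Section FdmodAct.
Variables (k : fieldType) (A : lalgType k) (S : A -> A -> Prop) (M : fdmod S).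
Local Notation "a '#' v" := (act M a v) (at level 40).

Lemma act0 v : 0 # v = 0.
Proof.
have := congr1 (fun f : 'End(M) => f v) (actD M 0 0).
by rewrite add_lfunE addr0 => /eqP; rewrite eq_sym -subr_eq0 addrK => /eqP.
Qed.

Lemma act_mul a b v : (a * b) # v = a # (b # v).
Proof. by rewrite actM comp_lfunE. Qed.

Lemma act_add a b v : (a + b) # v = a # v + b # v.
Proof. by rewrite actD add_lfunE. Qed.

Lemma act_scale c a v : (c *: a) # v = c *: (a # v).
Proof. by rewrite actZ scale_lfunE. Qed.

Lemma act_one v : 1 # v = v.
Proof. by rewrite act1 id_lfunE. Qed.

Lemma act_sub a b v : (a - b) # v = a # v - b # v.
Proof. by rewrite act_add -scaleN1r act_scale scaleN1r. Qed.

Lemma act_sum (I : Type) (r : seq I) (F : I -> relquot S) v :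
  (\sum_(i <- r) F i) # v = \sum_(i <- r) F i # v.
Proof. by apply: (big_morph (fun a => a # v)) => [a b|]; [exact: act_add|exact: act0]. Qed.

Lemma act_quotM x y v :
  to_quot S (x * y) # v = to_quot S x # (to_quot S y # v).
Proof. by rewrite -quotM act_mul. Qed.

Lemma act_quotB x y v : to_quot S (x - y) # v = to_quot S x # v - to_quot S y # v.
Proof. by rewrite -quotB act_sub. Qed.

Lemma act_quotZ c x v : to_quot S (c *: x) # v = c *: (to_quot S x # v).
Proof. by rewrite -quotZ act_scale. Qed.

Lemma act_rel x y v : S x y -> to_quot S x # v = to_quot S y # v.
Proof. by move=> /to_quot_rel ->. Qed.

End FdmodAct.

Section FreeQuot.
Variables (k : fieldType) (G : choiceType).
Variable S : free_alg k G -> free_alg k G -> Prop.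

(** An [lalgType] only relates scalars to the left factor. In the free algebra coefficients commute
    with monomials, which makes scalars central in the quotient. *)
Lemma relquot_scaleAr c (a b : relquot S) : c *: (a * b) = a * (c *: b).
Proof.
rewrite -(to_quot_repr a) -(to_quot_repr b).
rewrite quotM !quotZ quotM; congr to_quot.
set x := repr a; set y := repr b.
rewrite -[c *: y]mul_malgC -[c *: (x * y)]mul_malgC.
rewrite !mulrA; congr (_ * _).
rewrite !malgM_def fgmulUg fgmulgU; apply: eq_bigr => m _.
by rewrite mulrC mul1m mulm1.
Qed.

(** Every element is a combination of words in the generators, and a word grows from the empty one
    by prefixing letters. *)
Lemma relquot_ind (P : relquot S -> Prop) :
  P 0 -> P 1 -> (forall a b, P a -> P b -> P (a + b)) ->
  (forall c a, P a -> P (c *: a)) ->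
  (forall g a, P a -> P (to_quot S (free_gen k g) * a)) ->
  forall a, P a.
Proof.
move=> P0 P1 PD PZ PM a; rewrite -(to_quot_repr a); move: (repr a) => {}a.
have -> : a = \sum_(m <- msupp a) a@_m *: (mkmalgU m 1 : {malg k[{fmonom G}]}).
  rewrite {1}[a]monalgE; apply: eq_bigr => m _.
  by apply/malgP => m'; rewrite mcoeffZ !mcoeffU mulr_natr.
rewrite quot_sum; apply: (big_ind P) => // m _.
rewrite -quotZ; apply: PZ; case: m => s; elim: s => [|g s IH].
  suff -> : mkmalgU (FMonom [::]) 1 = 1 :> {malg k[{fmonom G}]} by [].
  by rewrite /GRing.one /=; congr mkmalgU; apply/val_inj; rewrite /= fm1.
suff -> : mkmalgU (FMonom (g :: s)) 1 =
          (free_gen k g : {malg k[{fmonom G}]}) * mkmalgU (FMonom s) 1.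
  by rewrite -quotM; apply: PM.
rewrite /free_gen malgM_def fgmulUU mulr1; congr mkmalgU.
by apply/val_inj; rewrite /= fmM fmU.
Qed.

End FreeQuot.

(** * Normal forms of braid words *)

(** Equality in the braid monoid, which preserves length. Squares are recorded separately, by
    [braid_sq]. *)
Inductive braid_eq : seq nat -> seq nat -> Prop :=
| BraidRefl w : braid_eq w w
| BraidSym v w : braid_eq v w -> braid_eq w v
| BraidTrans u v w : braid_eq u v -> braid_eq v w -> braid_eq u w
| BraidComm a b c d : (c.+1 < d)%N -> braid_eq (a ++ [:: c, d & b]) (a ++ [:: d, c & b])
| BraidRel a b c :
    braid_eq (a ++ [:: c.+1, c, c.+1 & b]) (a ++ [:: c, c.+1, c & b]).

Definition braid_sq w :=
  exists a c b, braid_eq w (a ++ [:: c, c & b]).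

Lemma braid_size v w : braid_eq v w -> size v = size w.
Proof.
elim=> [//|? ? _ -> //|? ? ? _ -> _ -> //|a b c d _|a b c];
  by rewrite !size_cat.
Qed.

Lemma braid_ctx a b v w : braid_eq v w -> braid_eq (a ++ v ++ b) (a ++ w ++ b).
Proof.
elim=> [?|? ? _|? ? ? _ h _|a' b' c d h|a' b' c].
- exact: BraidRefl.
- exact: BraidSym.
- exact: BraidTrans.
- by rewrite -!catA /= !(catA a); apply: BraidComm.
- by rewrite -!catA /= !(catA a); apply: BraidRel.
Qed.

Lemma braid_catl a v w : braid_eq v w -> braid_eq (a ++ v) (a ++ w).
Proof. by move=> /(braid_ctx a [::]); rewrite !cats0. Qed.

Lemma braid_catr b v w : braid_eq v w -> braid_eq (v ++ b) (w ++ b).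
Proof. exact: (braid_ctx [::]). Qed.

Lemma braid_cons c v w : braid_eq v w -> braid_eq (c :: v) (c :: w).
Proof. exact: (braid_catl [:: c]). Qed.

Lemma braid_far c s :
  (forall d, d \in s -> (c.+1 < d) || (d.+1 < c))%N -> braid_eq (c :: s) (s ++ [:: c]).
Proof.
elim: s => [|d s IH] far; first exact: BraidRefl.
apply: (@BraidTrans _ [:: d, c & s]); last first.
  by apply: braid_cons; apply: IH => x xs; apply: far; rewrite inE xs orbT.
have /orP[h|h] := far d (mem_head _ _); first exact: (BraidComm [::]).
by apply: BraidSym; apply: (BraidComm [::]).
Qed.

(** The letter [j] commutes past those below [j.-1], one braid move turns [j, j.-1, j] into
    [j.-1, j, j.-1], and the last [j.-1] commutes with the rest. *)
Lemma braid_shift1 k p j : (k < j < p)%N ->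
  braid_eq (j :: iota k (p - k)) (iota k (p - k) ++ [:: j.-1]).
Proof.
case: j => [//|j] /andP[kj jp] /=.
have -> : iota k (p - k) = iota k (j - k) ++ [:: j, j.+1 & iota j.+2 (p - j.+2)].
  have -> : (p - k = (j - k) + (p - j.+2).+2)%N by lia.
  by rewrite iotaD subnKC.
apply: (@BraidTrans _ (iota k (j - k) ++ [:: j.+1, j, j.+1 & iota j.+2 (p - j.+2)])).
  rewrite -cat_cons -(cat_rcons j.+1) -cats1; apply: braid_catr.
  by apply: braid_far => d; rewrite mem_iota; lia.
apply: (@BraidTrans _ (iota k (j - k) ++ [:: j, j.+1, j & iota j.+2 (p - j.+2)])).
  exact: BraidRel.
rewrite -catA; apply: braid_catl => /=; do 2!apply: braid_cons.
by apply: braid_far => d; rewrite mem_iota; lia.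
Qed.

Lemma braid_shift k p s : (forall j, j \in s -> k < j < p)%N ->
  braid_eq (s ++ iota k (p - k)) (iota k (p - k) ++ map predn s).
Proof.
elim: s => [|j s IH] h /=; first by rewrite cats0; apply: BraidRefl.
apply: (@BraidTrans _ (j :: (iota k (p - k) ++ map predn s))).
  by apply: braid_cons; apply: IH => x xs; apply: h; rewrite inE xs orbT.
rewrite -cat_cons -(cat_rcons j.-1) -cats1; apply: braid_catr.
by apply: braid_shift1; apply: h; rewrite mem_head.
Qed.

Lemma map_pred_iota k n : map predn (iota k.+1 n) = iota k n.
Proof. by elim: n k => //= n IH k; rewrite IH. Qed.

(** If [p' <= p], the left run except its first letter moves through the right run and leaves [k, k]
    in front. If [p < p'], the right run moves to the front, its letters raised by one. *)
Lemma braid_iota2 k p p' : (k < p)%N -> (k < p')%N ->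
  braid_sq (iota k (p' - k) ++ iota k (p - k)) \/
  (p < p')%N /\
  braid_eq (iota k (p' - k) ++ iota k (p - k))
           (iota k.+1 (p - k) ++ iota k (p' - k)).
Proof.
move=> kp kp'; have [le|lt] := leqP p' p; [left|right; split=> //].
  have -> : (iota k (p' - k) = k :: iota k.+1 (p' - k.+1))%N.
    by have -> : (p' - k = (p' - k.+1).+1)%N by lia.
  exists [::], k, (iota k.+1 (p - k.+1) ++ map predn (iota k.+1 (p' - k.+1))).
  apply: (@braid_cons k); rewrite -cat_cons.
  have -> : (k :: iota k.+1 (p - k.+1) = iota k (p - k))%N.
    by have -> : (p - k = (p - k.+1).+1)%N by lia.
  by apply: braid_shift => j; rewrite mem_iota; lia.
rewrite -{1}(map_pred_iota k (p - k)).
by apply: BraidSym; apply: braid_shift => j; rewrite mem_iota; lia.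
Qed.

Lemma braid_sq_ctx a b w : braid_sq w -> braid_sq (a ++ w ++ b).
Proof.
move=> [u [c [v /(braid_ctx a b) h]]]; exists (a ++ u), c, (v ++ b).
by rewrite -!catA /= in h *.
Qed.

Lemma braid_sq_eq v w : braid_eq v w -> braid_sq w -> braid_sq v.
Proof.
by move=> h [a [c [b h']]]; exists a, c, b; apply: BraidTrans h h'.
Qed.

(* Follows the strand that the permutation sends to position [k]. *)
Lemma braid_normal d k (w : seq nat) :
  (forall c, c \in w -> k <= c < k + d)%N ->
  braid_sq w \/
  exists (u : seq nat) p, [/\ (forall c, c \in u -> k.+1 <= c < k + d)%N,
                (k <= p <= k + d)%N
                & braid_eq w (u ++ iota k (p - k))].
Proof.
elim: d k w => [|d IHd] k w.
  case: w => [|c w] h; last by have := h c (mem_head _ _); lia.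
  right; exists [::], k; rewrite subnn; split=> //; first lia.
  exact: BraidRefl.
elim: w => [|c w IHw] h.
  right; exists [::], k; rewrite subnn; split=> //; first lia.
  exact: BraidRefl.
have hc := h c (mem_head _ _).
case: IHw => [x xw||[u [p [hu hp e]]]].
- by apply: h; rewrite inE xw orbT.
- by move=> /(braid_sq_ctx [:: c] [::]); rewrite cats0; left.
have [kc|ck] := ltnP k c.
  right; exists (c :: u), p; split=> //; last exact: braid_cons.
  by move=> x; rewrite inE => /orP[/eqP ->|/hu //]; lia.
have {ck hc}-> : c = k by lia.
have {}e : braid_eq (k :: w) (k :: (u ++ iota k (p - k))) by apply: braid_cons.
(* The new [k] need not commute with [u], so [u] is normalised once more, on one strand fewer. Then
   [k] commutes with [u'], whose letters are at least [k.+2], and prolongs the run that follows. *)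
case: (IHd k.+1 u) => [x /hu|sq|[u' [p' [hu' hp' e']]]]; first by lia.
  left; apply: braid_sq_eq e _; exact: (braid_sq_ctx [:: k] (iota k (p - k))).
have {e' u hu}e : braid_eq (k :: w)
    (u' ++ iota k (p' - k) ++ iota k (p - k)).
  apply: BraidTrans e _.
  apply: BraidTrans (braid_cons k (braid_catr _ e')) _.
  have -> : (iota k (p' - k) = [:: k] ++ iota k.+1 (p' - k.+1))%N.
    by have -> : (p' - k = (p' - k.+1).+1)%N by lia.
  rewrite -!catA (catA u' [:: k]) -(cat_cons k); apply: braid_catr.
  by apply: braid_far => x /hu'; lia.
have [kp|pk] := ltnP k p; last first.
  right; exists u', p'; split.
  - by move=> x /hu'; lia.
  - by lia.
  move: e; have -> : (p - k = 0)%N by lia.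
  rewrite cats0; exact: id.
have kp' : (k < p')%N by lia.
case: (braid_iota2 kp kp').
  move=> /(braid_sq_ctx u' [::]); rewrite cats0 => sq.
  by left; apply: braid_sq_eq e sq.
move=> [pp' e2]; right; exists (u' ++ iota k.+1 (p - k)), p'; split; last 2 first.
- lia.
- by rewrite -catA; apply: BraidTrans e _; apply: braid_catl.
by move=> x; rewrite mem_cat => /orP[/hu'|]; rewrite ?mem_iota; lia.
Qed.

(** * The quiver Hecke algebra *)

Section Filtration.
Variables (k : fieldType) (n : nat) (beta : Qplus n) (R : pzRingType) (sc : k -> R).
Local Notation m := (ht beta).
Variables (qe : Seq beta -> R) (qx : 'I_m -> R) (qt : 'I_m.-1 -> R).
Implicit Types (nu : Seq beta) (a b : R).

Hypothesis sc1 : sc 1 = 1.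
Hypothesis scD : {morph sc : c d / c + d}.
Hypothesis scM : {morph sc : c d / c * d}.
Hypothesis scC : forall c a, sc c * a = a * sc c.
Hypothesis qeM : forall nu nu', qe nu * qe nu' = if nu == nu' then qe nu else 0.
Hypothesis qte : forall c nu, qt c * qe nu = qe (seq_swap c nu) * qt c.
Hypothesis qtt : forall c d : 'I_m.-1, (c.+1 < d)%N || (d.+1 < c)%N ->
  qt c * qt d = qt d * qt c.
Hypothesis qtsq : forall c nu, qt c * qt c * qe nu =
  (if letter nu (lo c) == letter nu (hi c) then 0 else
   if letter nu (hi c) == (letter nu (lo c)).+1 :> nat then qx (lo c) - qx (hi c) else
   if letter nu (lo c) == (letter nu (hi c)).+1 :> nat then qx (hi c) - qx (lo c)
   else 1) * qe nu.
Hypothesis qtx : forall c x nu, exists e : k,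
  qx x * qt c * qe nu = qt c * qx (sw c x) * qe nu + sc e * qe nu.
Hypothesis qbraid : forall (c d : 'I_m.-1) nu, d = c.+1 :> nat -> exists e : k,
  (qt d * qt c * qt d - qt c * qt d * qt c) * qe nu = sc e * qe nu.

(** In the application the left ideal [I] is the common annihilator of vectors in two modules, so
    one scalar serves both. *)
Variables (mu : Seq beta) (I : R -> Prop).
Hypothesis I0 : I 0.
Hypothesis ID : forall a b, I a -> I b -> I (a + b).
Hypothesis IM : forall a b, I b -> I (a * b).

Lemma sc_mulA c a b : a * (sc c * b) = sc c * (a * b).
Proof. by rewrite mulrA -scC mulrA. Qed.

Lemma sc0 : sc 0 = 0.
Proof. by apply: (addrI (sc 0)); rewrite -scD !addr0. Qed.

Lemma scN c : sc (- c) = - sc c.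
Proof. by apply/eqP; rewrite -addr_eq0 -scD addNr sc0. Qed.

Lemma qe_idem nu : qe nu * qe nu = qe nu.
Proof. by rewrite qeM eqxx. Qed.

(** With zero out of range, words over [nat] need no bounds: the commutation and braid moves remain
    valid there. *)
Definition tau (c : nat) : R := if insub c is Some c' then qt c' else 0.
Definition swap_at (c : nat) nu := if insub c is Some c' then seq_swap c' nu else nu.

Lemma tau_qe c nu : tau c * qe nu = qe (swap_at c nu) * tau c.
Proof.
by rewrite /tau /swap_at; case: insub => [c'|]; [exact: qte|rewrite mul0r mulr0].
Qed.

Lemma tau_comm (c d : nat) : (c.+1 < d)%N -> tau c * tau d = tau d * tau c.
Proof.
move=> h; rewrite /tau; case: insubP => [c' _ ec|]; last by rewrite mul0r mulr0.
case: insubP => [d' _ ed|]; last by rewrite mul0r mulr0.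
by apply: qtt; rewrite ec ed h.
Qed.

Definition tau_word (w : seq nat) : R := foldr (fun c a => tau c * a) (qe mu) w.
Definition word_act (w : seq nat) : Seq beta := foldr swap_at mu w.

(** The length filtration modulo [I]. The bound is strict, so that [short_span (size w)] is the
    error allowed when [tau_word w] is rewritten. *)
Inductive short_span (j : nat) : R -> Prop :=
| SpI a : I a -> short_span j a
| SpD a b : short_span j a -> short_span j b -> short_span j (a + b)
| SpZ (c : k) a : short_span j a -> short_span j (sc c * a)
| SpW w : (size w < j)%N -> short_span j (tau_word w).

Lemma short_span_weaken i j a : (i <= j)%N -> short_span i a -> short_span j a.
Proof.
move=> ij; elim=> [b h|b c _ hb _ hc|c b _ hb|w h].
- exact: SpI.
- exact: SpD.
- exact: SpZ.
- by apply: SpW; apply: leq_trans h ij.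
Qed.

Lemma short_span_tau c j a : short_span j a -> short_span j.+1 (tau c * a).
Proof.
elim=> [b h|b d _ hb _ hd|d b _ hb|w h].
- by apply: SpI; apply: IM.
- by rewrite mulrDr; apply: SpD.
- by rewrite sc_mulA; apply: SpZ.
- exact: (@SpW _ (c :: w)).
Qed.

Lemma qe_tau_word w : qe (word_act w) * tau_word w = tau_word w.
Proof.
elim: w => [|c w IH] /=; first exact: qe_idem.
by rewrite -{2}IH !mulrA tau_qe.
Qed.

Lemma qe_tau_word_neq nu w : nu != word_act w -> qe nu * tau_word w = 0.
Proof. by move=> h; rewrite -qe_tau_word mulrA qeM (negbTE h) mul0r. Qed.

Lemma short_span_qe nu j a : short_span j a -> short_span j (qe nu * a).
Proof.
elim=> [b h|b d _ hb _ hd|d b _ hb|w h].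
- by apply: SpI; apply: IM.
- by rewrite mulrDr; apply: SpD.
- by rewrite sc_mulA; apply: SpZ.
have [->|/qe_tau_word_neq ->] := eqVneq nu (word_act w); last exact: SpI.
by rewrite qe_tau_word; apply: SpW.
Qed.

Hypothesis Ix : forall x, I (qx x * qe mu).

(** Moving [x] to the right through a [tau] costs a scalar times the word without that [tau]; on
    reaching [qe mu] it falls into [I]. *)
Lemma short_span_qx_word x w : short_span (size w) (qx x * tau_word w).
Proof.
elim: w x => [|c w IH] x /=; first exact/SpI/Ix.
rewrite /tau; case: insubP => [c' _ ec|_]; last first.
  by rewrite mul0r mulr0; apply: SpI.
rewrite -(qe_tau_word w) !mulrA; have [e ->] := qtx c' x (word_act w).
rewrite mulrDl -mulrA qe_tau_word -mulrA; apply: SpD.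
  have := short_span_tau c (IH (sw c' x)); rewrite /tau.
  by case: insubP => [d _ ed|]; [have -> : d = c' by apply/val_inj; rewrite ed ec|
     rewrite -ec ltn_ord].
by rewrite -mulrA qe_tau_word; apply: SpZ; apply: SpW => /=.
Qed.

Lemma short_span_qx x j a : short_span j a -> short_span j (qx x * a).
Proof.
elim=> [b h|b d _ hb _ hd|d b _ hb|w h].
- by apply: SpI; apply: IM.
- by rewrite mulrDr; apply: SpD.
- by rewrite sc_mulA; apply: SpZ.
by apply: short_span_weaken (short_span_qx_word x w); apply: ltnW.
Qed.

Lemma short_span_sub j a b : short_span j a -> short_span j b -> short_span j (a - b).
Proof. by move=> ha hb; rewrite -[b]mul1r -mulNr -sc1 -scN; apply: SpD => //; apply: SpZ. Qed.

(** A squared [tau] acts as zero, one or a difference of two [x]'s, and an [x] does not lengthen a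
    word, so two letters are lost. *)
Lemma short_span_sq (w v : seq nat) c : short_span (size w + size v).+1 
   (foldr (fun c a => tau c * a) (tau c * (tau c * tau_word v)) w).
Proof.
elim: w => [|d w IH] /=; last exact: short_span_tau.
rewrite /tau; case: insubP => [c' _ ec|_]; last first.
  by rewrite mul0r; apply: SpI.
rewrite -(qe_tau_word v) !mulrA qtsq -mulrA qe_tau_word.
do 3?[case: ifP => _]; rewrite ?mul0r ?mul1r ?mulrBl.
- exact: SpI.
- apply: short_span_sub; apply: short_span_weaken (short_span_qx_word _ _) => //.
- apply: short_span_sub; apply: short_span_weaken (short_span_qx_word _ _) => //.
- exact: SpW.
Qed.

Lemma short_span_foldr w j a : short_span j a -> short_span (size w + j) (foldr (fun c a => tau c * a) a w).
Proof. by move=> h; elim: w => //= c w; exact: short_span_tau. Qed.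

Lemma foldr_tauB w a b : foldr (fun c a => tau c * a) (a - b) w =
  foldr (fun c a => tau c * a) a w - foldr (fun c a => tau c * a) b w.
Proof. by elim: w => //= c w ->; rewrite mulrBr. Qed.

(** Distant [tau]'s commute exactly, and a braid move has a scalar error, hence a word three letters
    shorter. *)
Lemma short_span_braid v w : braid_eq v w -> short_span (size v) (tau_word v - tau_word w).
Proof.
elim=> [u|u u' e|u u' u'' e h e' h'|a b c d cd|a b c].
- by rewrite subrr; apply: SpI.
- by rewrite -(braid_size e) => h; rewrite -opprB -[tau_word u - _]mul1r -mulNr -sc1 -scN; apply: SpZ.
- rewrite -(subrKA (tau_word u')); apply: SpD => //.
  by rewrite (braid_size e).
- by rewrite /tau_word !foldr_cat /= !mulrA (tau_comm cd) subrr; apply: SpI.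
rewrite /tau_word !foldr_cat -foldr_tauB size_cat; apply: short_span_foldr => /=.
rewrite -/(tau_word b) /tau; case: insubP => [d _ ed|_]; last first.
  by rewrite !mul0r mulr0 subrr; apply: SpI.
case: insubP => [c' _ ec|_]; last first.
  by rewrite !mul0r mulr0 subrr; apply: SpI.
rewrite -(qe_tau_word b) !mulrA -!mulrBl.
have [|e ->] := @qbraid c' d (word_act b); first by rewrite ed ec.
by rewrite -mulrA qe_tau_word; apply: SpZ; apply: SpW; lia.
Qed.

Lemma short_span_dead w : braid_sq w -> short_span (size w) (tau_word w).
Proof.
move=> [a [c [b e]]]; rewrite -[tau_word w](subrK (tau_word (a ++ [:: c, c & b]))).
apply: SpD; first exact: short_span_braid.
rewrite (braid_size e) /tau_word foldr_cat /=.
apply: short_span_weaken (short_span_sq _ _ _); rewrite size_cat /=; lia.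
Qed.

(* Adjacent letters in increasing order are swapped into a bigger word, so
   [It] is where maximality enters. *)
Hypothesis It : forall c : 'I_m.-1,
  (letter mu (lo c) < letter mu (hi c))%N -> I (qt c * qe mu).
Hypothesis mu_desc : forall x y : 'I_m, (x < y)%N -> letter mu x = letter mu y ->
  exists2 c : 'I_m.-1, hi c = y & (letter mu (lo c) < letter mu (hi c))%N.

Lemma letter_swap_at_lt c nu (x : 'I_m) : (x < c)%N -> letter (swap_at c nu) x = letter nu x.
Proof.
move=> xc; rewrite /swap_at; case: insubP => [c' _ ec|//].
rewrite /letter tnth_mktuple /sw tpermD // -val_eqE /= ec; lia.
Qed.

Lemma letter_swap_at_eq c nu (x y : 'I_m) : x = c :> nat -> y = c.+1 :> nat ->
  letter (swap_at c nu) x = letter nu y.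
Proof.
move=> xc yc; rewrite /swap_at; case: insubP => [c' _ ec|]; last first.
  by have := ltn_ord y; rewrite -leqNgt; lia.
have -> : x = lo c' by apply/val_inj; rewrite /= xc ec.
have -> : y = hi c' by apply/val_inj; rewrite /= yc ec.
by rewrite /letter tnth_mktuple /sw tpermL.
Qed.

(** The rightmost generator acts first: it takes the strand at [y] one step down, and the others
    carry it on to [x]. *)
Lemma letter_act_run (x y : 'I_m) d : (y = x + d :> nat)%N ->
  letter (word_act (iota x d)) x = letter mu y.
Proof.
elim: d x => [|d IH] x yx; first by congr letter; apply/val_inj; rewrite /= yx addn0.
have x1m : (x.+1 < m)%N by have := ltn_ord y; lia.
rewrite /= (@letter_swap_at_eq _ _ _ (Ordinal x1m)) //; apply: (IH (Ordinal x1m)) => /=; lia.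
Qed.

Lemma letter_act_lt (x : 'I_m) u w : (forall c, c \in u -> x < c)%N ->
  letter (word_act (u ++ w)) x = letter (word_act w) x.
Proof.
elim: u => [//|c u IH] h /=; rewrite letter_swap_at_lt; last exact/h/mem_head.
by apply: IH => d du; apply: h; rewrite inE du orbT.
Qed.

Definition scalar_mod a := exists c : k, I (a - sc c * qe mu).

Lemma scalar_modI a : I a -> scalar_mod a.
Proof. by move=> h; exists 0; rewrite sc0 mul0r subr0. Qed.

Lemma scalar_modD a b : scalar_mod a -> scalar_mod b -> scalar_mod (a + b).
Proof.
move=> [c hc] [d hd]; exists (c + d); rewrite scD mulrDl opprD addrACA.
exact: ID.
Qed.

Lemma scalar_modZ d a : scalar_mod a -> scalar_mod (sc d * a).
Proof.
by move=> [c hc]; exists (d * c); rewrite scM -mulrA -mulrBr; apply: IM.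
Qed.

(** Induction on the number [d] of positions above [x]. The normal form isolates, at the right end
    of the word, the strand that runs from [p] to [x]. If this run is empty, the remaining word
    lives above [x]. *)
Lemma short_span_scalar_step j d x (w : seq nat) :
  (forall a, short_span j a -> scalar_mod (qe mu * a)) -> (x + d = m.-1)%N ->
  (forall c, c \in w -> x <= c < m.-1)%N -> size w = j ->
  scalar_mod (qe mu * tau_word w).
Proof.
move=> dead; elim: d x w => [|d IHd] x w xd hx wj.
  case: w hx wj => [_ _|c w hx _]; last first.
    by have := hx c (mem_head _ _); lia.
  exists 1; rewrite sc1 mul1r /= qe_idem subrr; exact: I0.
have xw c : c \in w -> (x <= c < x + d.+1)%N by move/hx; lia.
have [|] := braid_normal xw; first by move=> /short_span_dead; rewrite wj; exact: dead.
move=> [u [p [hu hp e]]].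
rewrite -[tau_word w](subrK (tau_word (u ++ iota x (p - x)))) mulrDr.
apply: scalar_modD; first by apply: dead; rewrite -wj; apply: short_span_braid.
have [xp|px] := ltnP x p; last first.
  move: e; have -> : (p - x = 0)%N by lia.
  rewrite cats0 => e; apply: (IHd x.+1) => //.
  - lia.
  - by move=> c /hu; lia.
  - by rewrite -(braid_size e).
have pm : (p.-1 < m.-1)%N by lia.
pose c := Ordinal pm.
have tnc : tau p.-1 = qt c.
  rewrite /tau; case: insubP => [c' _ ec|]; last by rewrite pm.
  by congr qt; apply/val_inj.
have xm : (x < m)%N by lia.
(* The generator [p.-1] acts first on [qe mu]; at an ascent of [mu] it falls into [I], and the whole
   word with it. *)
have [lt|ge] := ltnP (letter mu (lo c)) (letter mu (hi c)).
  apply/scalar_modI/IM; rewrite /tau_word; have -> : (p - x = (p.-1 - x) + 1)%N by lia.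
  rewrite iotaD subnKC; last lia.
  rewrite catA foldr_cat /= tnc.
  elim: (_ ++ _) => [|f s IHs] /=; [exact: It|exact: IM].
(* Otherwise the product vanishes unless the word fixes [mu]. In that case [mu] would have equal
   letters at [x] and [p], and [mu_desc] would put an ascent at [p.-1]. *)
rewrite qe_tau_word_neq; first exact: scalar_modI.
apply/eqP => E.
have : letter mu (Ordinal xm) = letter mu (hi c).
  rewrite {1}E (@letter_act_lt (Ordinal xm)); last by move=> f /hu /andP[].
  by apply: letter_act_run => /=; lia.
case/(@mu_desc (Ordinal xm)) => [/=|c' ec']; first lia.
have -> : c' = c by apply/val_inj; move/(congr1 val): ec' => /=; lia.
by rewrite ltnNge ge.
Qed.

Lemma short_span_scalar j a : short_span j a -> scalar_mod (qe mu * a).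
Proof.
elim: j a => [|j IHj] a.
  elim=> [b h|b d _ hb _ hd|d b _ hb|//].
  - by apply: scalar_modI; apply: IM.
  - by rewrite mulrDr; apply: scalar_modD.
  - by rewrite sc_mulA; apply: scalar_modZ.
elim=> [b h|b d _ hb _ hd|d b _ hb|w].
- by apply: scalar_modI; apply: IM.
- by rewrite mulrDr; apply: scalar_modD.
- by rewrite sc_mulA; apply: scalar_modZ.
rewrite ltnS leq_eqVlt => /orP[/eqP wj|wj]; last by apply/IHj/SpW.
have [/allP wm|/allPn[c cw cm]] := boolP (all (fun c => c < m.-1)%N w); last first.
  suff -> : tau_word w = 0 by rewrite mulr0; apply: scalar_modI.
  elim: w cw {wj} => [//|d w IHw]; rewrite inE => /orP[/eqP <-|/IHw /= ->].
    by rewrite /= /tau insubN ?mul0r.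
  by rewrite mulr0.
apply: (@short_span_scalar_step j m.-1 0 w IHj) => // c /wm ->.
Qed.

Hypothesis R_ind : forall P : R -> Prop, P 0 -> P 1 ->
  (forall a b, P a -> P b -> P (a + b)) -> (forall c a, P a -> P (sc c * a)) ->
  (forall nu a, P a -> P (qe nu * a)) -> (forall x a, P a -> P (qx x * a)) ->
  (forall c a, P a -> P (qt c * a)) -> forall a, P a.

(** Multiplication by an [e] or an [x] preserves the filtration and a [tau] raises it by one, so it
    exhausts the left ideal of [qe mu]. *)
Lemma short_span_gen a : exists j, short_span j (a * qe mu).
Proof.
elim/R_ind: a => [||a b [i hi] [j hj]|c a [j hj]|nu a [j hj]|x a [j hj]|c a [j hj]].
- by exists 0%N; rewrite mul0r; apply: SpI.
- by exists 1%N; rewrite mul1r; exact: (@SpW _ [::]).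
- exists (maxn i j); rewrite mulrDl; apply: SpD.
    by apply: short_span_weaken hi; apply: leq_maxl.
  by apply: short_span_weaken hj; apply: leq_maxr.
- by exists j; rewrite -mulrA; apply: SpZ.
- by exists j; rewrite -mulrA; apply: short_span_qe.
- by exists j; rewrite -mulrA; apply: short_span_qx.
exists j.+1; rewrite -mulrA; have := short_span_tau c hj; rewrite /tau.
by case: insubP => [d _ /val_inj ->|]; rewrite ?ltn_ord.
Qed.

Lemma corner_scalar a : exists c : k, I (qe mu * a * qe mu - sc c * qe mu).
Proof. by have [j /short_span_scalar] := short_span_gen a; rewrite -mulrA. Qed.

End Filtration.

(** * The defining relations and the induction principle of [qh_alg] *)

Section QuiverHecke.
Variables (k : fieldType) (n : nat) (beta : Qplus n).
Local Notation R := (qh_alg k beta).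
Local Notation m := (ht beta).
Local Notation qe := (@qe k n beta).
Local Notation qx := (@qx k n beta).
Local Notation qt := (@qt k n beta).
Implicit Types (nu mu : Seq beta) (a b : R).

Lemma qeM nu nu' : qe nu * qe nu' = if nu == nu' then qe nu else 0.
Proof.
have := to_quot_rel (qh_ee k nu nu'); rewrite -quotM => ->.
by case: eqP => _ //; exact: quot0.
Qed.

Lemma qe_sum : \sum_nu qe nu = 1.
Proof. by have := to_quot_rel (qh_sum1 k beta); rewrite quot_sum. Qed.

Lemma qxe x nu : qx x * qe nu = qe nu * qx x.
Proof. rewrite [LHS]quotM [RHS]quotM; exact: to_quot_rel (qh_xe k x nu). Qed.

Lemma qte c nu : qt c * qe nu = qe (seq_swap c nu) * qt c.
Proof. rewrite [LHS]quotM [RHS]quotM; exact: to_quot_rel (qh_te k c nu). Qed.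

Lemma qtt (c d : 'I_m.-1) : (c.+1 < d)%N || (d.+1 < c)%N -> qt c * qt d = qt d * qt c.
Proof. move=> h; rewrite [LHS]quotM [RHS]quotM; exact: to_quot_rel (qh_tt k h). Qed.

Lemma qtsq c nu : qt c * qt c * qe nu =
  (if letter nu (lo c) == letter nu (hi c) then 0 else
   if letter nu (hi c) == (letter nu (lo c)).+1 :> nat then qx (lo c) - qx (hi c) else
   if letter nu (lo c) == (letter nu (hi c)).+1 :> nat then qx (hi c) - qx (lo c)
   else 1) * qe nu.
Proof.
rewrite [qt c * qt c]quotM [LHS]quotM.
apply: etrans (to_quot_rel (qh_tsq k c nu)) _.
apply: etrans (esym (quotM _ _ _)) _; congr (_ * _).
rewrite /Qpol; case: ifP => _; first exact: quot0.
by do 2![case: ifP => _; first by rewrite quotB].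
Qed.

Lemma qtx_rel c x nu : (qt c * qx (sw c x) - qx x * qt c) * qe nu =
    to_quot _ (if letter nu (lo c) == letter nu (hi c) then
                 if sw c x == lo c then - fe k nu else
                 if sw c x == hi c then fe k nu else 0 else 0).
Proof.
(* The relation is taken at [sw c x], so that the index to the left of [tau] becomes [x]. *)
apply: etrans (to_quot_rel (qh_tx k c (sw c x) nu)).
rewrite {3}/sw tpermK [qt c * _]quotM [qx x * _]quotM quotB.
by rewrite [LHS]quotM.
Qed.

Lemma qbraid (c d : 'I_m.-1) nu : d = c.+1 :> nat -> exists e : k,
  (qt d * qt c * qt d - qt c * qt d * qt c) * qe nu = e *: qe nu.
Proof.
move=> cd; have h := to_quot_rel (qh_braid k nu cd).
exists (if letter nu (lo c) == letter nu (hi d) then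
  (Qdiv (letter nu (lo c)) (letter nu (hi c)))%:~R else 0).
rewrite [qt d * qt c]quotM [qt c * qt d]quotM.
rewrite [X in X - _]quotM [X in _ - X]quotM quotB [LHS]quotM.
apply: etrans h _; rewrite quotZ; case: ifP => _; last by rewrite scale0r.
by rewrite scaler_int mulrzl.
Qed.

Lemma qtx c x nu : exists e : k,
  qx x * qt c * qe nu = qt c * qx (sw c x) * qe nu + e *: qe nu.
Proof.
have sub (S : pzRingType) (u v w r : S) : (u - v) * w = r -> v * w = u * w - r.
  by move=> <-; rewrite mulrBl subKr.
have E := sub _ _ _ _ _ (qtx_rel c x nu).
suff [e he] : exists e : k, - to_quot (@qh_rel k n beta)
    (if letter nu (lo c) == letter nu (hi c) then
       if sw c x == lo c then - fe k nu else
       if sw c x == hi c then fe k nu else 0 else 0) = e *: qe nu.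
  by exists e; apply: etrans E _; congr (_ + _).
case: ifP => _; [case: ifP => _; [|case: ifP => _] |].
- by exists 1; rewrite scale1r -quotN opprK.
- by exists (-1); rewrite scaleN1r.
- by exists 0; rewrite scale0r quot0 oppr0.
- by exists 0; rewrite scale0r quot0 oppr0.
Qed.

Lemma qh_ind (P : R -> Prop) :
  P 0 -> P 1 -> (forall a b, P a -> P b -> P (a + b)) ->
  (forall c a, P a -> P (c *: a)) ->
  (forall nu a, P a -> P (qe nu * a)) ->
  (forall x a, P a -> P (qx x * a)) ->
  (forall c a, P a -> P (qt c * a)) ->
  forall a, P a.
Proof.
move=> P0 P1 PD PZ Pe Px Pt; apply: relquot_ind => // -[[nu|x]|c] a.
- exact: Pe.
- exact: Px.
- exact: Pt.
Qed.

End QuiverHecke.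

(** * Graded simple modules *)

(** Starting from zero, vectors satisfying [P] are adjoined as long as any is missing; the
    codimension bounds the number of steps. *)
Lemma vspace_of_pred (k : fieldType) (V : vectType k) (P : V -> Prop) :
  P 0 -> (forall (c : k) u v, P u -> P v -> P (c *: u + v)) ->
  exists U : {vspace V}, forall u, u \in U <-> P u.
Proof.
move=> P0 PL.
have [d] := ubnP (\dim (fullv : {vspace V}) - \dim (0%VS : {vspace V}))%N.
have : forall u, u \in (0%VS : {vspace V}) -> P u.
  by move=> u; rewrite memv0 => /eqP ->.
elim: d (0%VS : {vspace V}) => // d IHd U UP hd.
have [[u [Pu uU]]|all] := pselect (exists u, P u /\ u \notin U); last first.
  exists U => u; split=> [/UP //|Pu].
  by apply/negPn/negP => uU; apply: all; exists u.
apply: (IHd (U + <[u]>)%VS) => [w|].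
  move=> /memv_addP[a /UP Pa [b /vlineP[c ->] ->]].
  by rewrite addrC; apply: PL.
have lt : (\dim U < \dim (U + <[u]>))%N.
  rewrite ltn_neqAle dimvS ?addvSl // andbT; apply: contra uU => /eqP e.
  have /eqP -> : U == (U + <[u]>)%VS by rewrite eqEdim addvSl e leqnn.
  by rewrite (subvP (addvSr _ _)) // memv_line.
have := dimvS (subvf (U + <[u]>)%VS); lia.
Qed.

Lemma seq_int_max (s : seq int) (P : int -> Prop) d :
  d \in s -> P d -> exists2 e, P e & forall e', e' \in s -> P e' -> e' <= e.
Proof.
elim: s d => [//|x s IH] d.
have [[e es Pe]|none] := pselect (exists2 e, e \in s & P e); last first.
  rewrite inE => /orP[/eqP -> Px|ds Pd]; last by case: none; exists d.
  exists x => // e'; rewrite inE => /orP[/eqP -> //|e's Pe'].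
  by case: none; exists e'.
move=> _ _; have [y Py ymax] := IH _ es Pe.
have [[Px yx]|h] := pselect (P x /\ y <= x).
  exists x => // e'; rewrite inE => /orP[/eqP -> //|/ymax h Pe'].
  by apply: le_trans yx; apply: h.
exists y => // e'; rewrite inE => /orP[/eqP -> Px|/ymax //].
by case: (leP y x) => [yx|/ltW //]; case: h.
Qed.

Section Graded.
Variables (k : fieldType) (n : nat) (beta : Qplus n).
Local Notation R := (qh_alg k beta).
Local Notation m := (ht beta).
Local Notation qe := (@qe k n beta).
Local Notation qx := (@qx k n beta).
Local Notation qt := (@qt k n beta).

Lemma big_subseq_support (V : nmodType) (s t : seq int) (F : int -> V) :
  uniq s -> uniq t -> {subset s <= t} -> (forall d, d \notin s -> F d = 0) ->
  \sum_(d <- t) F d = \sum_(d <- s) F d.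
Proof.
move=> us ut st F0; rewrite (bigID (mem s)) /= [X in _ + X]big1 ?addr0 //.
rewrite -big_filter; apply: perm_big; apply: uniq_perm; rewrite ?filter_uniq //.
by move=> d; rewrite mem_filter; case: (boolP (d \in s)) => //= /st.
Qed.

(** Only a decomposition is asserted; the separation of degrees comes from the modules, through
    [gcomp_indep]. *)
Definition gdecomp (a : R) (A : int -> R) (s : seq int) : Prop :=
  [/\ uniq s, forall d, homog d (A d), forall d, d \notin s -> A d = 0
    & a = \sum_(d <- s) A d].

(** The degree of [tau] depends on the word it meets, so the generators are first cut by the
    idempotents, which sum to one. *)
Lemma gdecomp_exists a : exists A s, gdecomp a A s.
Proof.
pose P a := exists A s, gdecomp a A s.
have PD a1 a2 : P a1 -> P a2 -> P (a1 + a2).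
  move=> [A [s [us hA A0 ->]]] [B [t [ut hB B0 ->]]].
  exists (fun d => A d + B d), (undup (s ++ t)); split.
  - exact: undup_uniq.
  - by move=> d; apply: homog_D.
  - move=> d; rewrite mem_undup mem_cat negb_or => /andP[/A0 -> /B0 ->].
    by rewrite addr0.
  have us' := undup_uniq (s ++ t).
  have ss : {subset s <= undup (s ++ t)}.
    by move=> d ds; rewrite mem_undup mem_cat ds.
  have ts : {subset t <= undup (s ++ t)}.
    by move=> d dt; rewrite mem_undup mem_cat dt orbT.
  rewrite -(big_subseq_support us us' ss A0) -(big_subseq_support ut us' ts B0).
  by rewrite big_split.
have P0 : P 0.
  by exists (fun=> 0), [::]; split=> //; [move=> d; exact: homog_0|rewrite big_nil].
have PM d b a1 : homog d b -> P a1 -> P (b * a1).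
  move=> hb [A [s [us hA A0 ->]]].
  exists (fun e => b * A (e - d)), [seq d + e | e <- s]; split.
  - by rewrite map_inj_uniq //; apply: addrI.
  - by move=> e; rewrite -[X in homog X](subrKC d); apply: homog_M.
  - move=> e he; rewrite A0 ?mulr0 //; apply: contra he => he.
    by apply/mapP; exists (e - d) => //; rewrite subrKC.
  by rewrite big_map mulr_sumr; apply: eq_bigr => e _; rewrite addrAC subrr add0r.
have PS (F : Seq beta -> R) a1 : (forall nu, exists d, homog d (F nu)) ->
    P a1 -> P ((\sum_nu F nu) * a1).
  move=> hF Pa; rewrite mulr_suml; apply: big_ind => // nu _.
  by have [d hd] := hF nu; apply: PM hd Pa.
have cut b : b = \sum_nu b * qe nu by rewrite -mulr_sumr qe_sum mulr1.
elim/qh_ind: a => [//||||nu a Pa|x a Pa|c a Pa].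
- rewrite -[1]mulr1 -{1}(qe_sum k beta); apply: PS => [nu|].
    by exists 0; apply: homog_e.
  exists (fun d => if d == 0 then 1 else 0), [:: 0]; split=> //.
  - move=> d; case: eqP => [->|_]; last exact: homog_0.
    rewrite -(qe_sum k beta); apply: (big_ind (homog 0)).
    + exact: homog_0.
    + exact: homog_D.
    + by move=> nu _; apply: homog_e.
  - by move=> d; rewrite inE => /negbTE ->.
  - by rewrite big_seq1 eqxx.
- exact: PD.
- move=> c a [A [s [us hA A0 ->]]]; exists (fun d => c *: A d), s; split=> //.
  + by move=> d; apply: homog_Z.
  + by move=> d /A0 ->; rewrite scaler0.
  + by rewrite scaler_sumr.
- by apply: PM Pa; apply: homog_e.
- by rewrite (cut (qx x)); apply: PS => // nu; exists 2; apply: homog_x.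
- by rewrite (cut (qt c)); apply: PS => // nu; eexists; apply: homog_t.
Qed.

Section OneModule.
Variable M : gmod k beta.
Local Notation "a '#' v" := (act M a v) (at level 40).

Lemma act_gcomp d d' a v : homog d a -> v \in gcomp M d' -> a # v \in gcomp M (d + d').
Proof. move=> ha hv; have /subvP h := @gact _ _ _ M d d' a ha.
by apply: h; apply: memv_img. Qed.

(** Directness is given on [gsupp M] only. Components vanish elsewhere, so a family on any [s] is
    transferred there, extended by zero. *)
Lemma gcomp_indep (u : int -> M) s : uniq s -> (forall d, u d \in gcomp M d) ->
  \sum_(d <- s) u d = 0 -> forall d, d \in s -> u d = 0.
Proof.
move=> us hu.
have out d : d \notin gsupp M -> u d = 0.
  by move=> h; apply/eqP; rewrite -memv0 -(gsuppP h).
pose w d := if d \in s then u d else 0.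
have -> : \sum_(d <- s) u d = \sum_(d <- gsupp M) w d.
  have tu := undup_uniq (s ++ gsupp M).
  have h1 : {subset s <= undup (s ++ gsupp M)}.
    by move=> d ds; rewrite mem_undup mem_cat ds.
  have h2 : {subset gsupp M <= undup (s ++ gsupp M)}.
    by move=> d ds; rewrite mem_undup mem_cat ds orbT.
  have w1 d : d \notin s -> w d = 0 by rewrite /w => /negbTE ->.
  have w2 d : d \notin gsupp M -> w d = 0 by move=> /out; rewrite /w; case: ifP.
  rewrite -(big_subseq_support (gsupp_uniq M) tu h2 w2).
  rewrite (big_subseq_support us tu h1 w1) [LHS]big_seq [RHS]big_seq.
  by apply: eq_bigr => d; rewrite /w => ->.
move=> w0 d ds; have [dg|/out //] := boolP (d \in gsupp M).
have dir : directv (\sum_(i < size (gsupp M)) gcomp M (tnth (in_tuple (gsupp M)) i)).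
  have := gdirect M; rewrite directvE /= !(big_tnth _ _ (gsupp M)) => h.
  by rewrite directvE.
have /directv_sum_independent H := dir.
have {}H := H (fun i => w (tnth (in_tuple (gsupp M)) i)).
rewrite (big_tnth _ _ (gsupp M)) in w0.
have {}H := H _ w0.
have /(nthP 0) [i hi ei] := dg.
have wd : w d = u d by rewrite /w ds.
rewrite -wd -ei; have := H _ (Ordinal hi) isT; rewrite (tnth_nth 0) /=; apply.
by move=> j _; rewrite /w; case: ifP => // _; apply: mem0v.
Qed.

End OneModule.
End Graded.

(** * Highest weight vectors and cyclicity in graded simple modules *)

Section SimpleUnique.
Variables (k : fieldType) (n : nat) (beta : Qplus n).
Local Notation R := (qh_alg k beta).
Local Notation m := (ht beta).
Local Notation qe := (@qe k n beta).
Local Notation qx := (@qx k n beta).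
Local Notation qt := (@qt k n beta).
Local Notation "a '#' v" := (act _ a v) (at level 40).

(** The abstract scalars become [c *: 1], central by [relquot_scaleAr]. *)
Lemma qh_corner (mu : Seq beta) (I : R -> Prop) :
  I 0 -> (forall a b, I a -> I b -> I (a + b)) -> (forall a b, I b -> I (a * b)) ->
  (forall x, I (qx x * qe mu)) ->
  (forall c : 'I_m.-1, (letter mu (lo c) < letter mu (hi c))%N -> I (qt c * qe mu)) ->
  (forall x y : 'I_m, (x < y)%N -> letter mu x = letter mu y ->
    exists2 c : 'I_m.-1, hi c = y & (letter mu (lo c) < letter mu (hi c))%N) ->
  forall a, exists c : k, I (qe mu * a * qe mu - c *: qe mu).
Proof.
move=> I0 ID IM Ix It hmu a.
pose sc (c : k) : R := c *: (1 : R).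
have sE (c : k) (b : R) : sc c * b = c *: b by rewrite -relquot_scaleAl mul1r.
have sEr (c : k) (b : R) : b * sc c = c *: b by rewrite -relquot_scaleAr mulr1.
have sc1 : sc 1 = 1 by rewrite /sc scale1r.
have scD : {morph sc : c d / c + d} by move=> c d; rewrite /sc scalerDl.
have scM : {morph sc : c d / c * d} by move=> c d; rewrite sE /sc scalerA.
have scC c b : sc c * b = b * sc c by rewrite sE sEr.
have tx c x nu : exists e : k,
    qx x * qt c * qe nu = qt c * qx (sw c x) * qe nu + sc e * qe nu.
  by have [e he] := @qtx k n beta c x nu; exists e; rewrite sE.
have br (c d : 'I_m.-1) nu : d = c.+1 :> nat -> exists e : k,
    (qt d * qt c * qt d - qt c * qt d * qt c) * qe nu = sc e * qe nu.
  by move=> h; have [e he] := @qbraid k n beta c d nu h; exists e; rewrite sE.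
have ind (P : R -> Prop) : P 0 -> P 1 -> (forall a b, P a -> P b -> P (a + b)) ->
    (forall c a, P a -> P (sc c * a)) ->
    (forall nu a, P a -> P (qe nu * a)) -> (forall x a, P a -> P (qx x * a)) ->
    (forall c a, P a -> P (qt c * a)) -> forall a, P a.
  move=> P0 P1 PD PZ Pe Px Pt; apply: qh_ind => // c b Pb.
  by rewrite -sE; apply: PZ.
have [c] := @corner_scalar k n beta R sc qe qx qt sc1 scD scM scC
  (@qeM k n beta) (@qte k n beta) (@qtt k n beta) (@qtsq k n beta) tx br mu I
  I0 ID IM Ix It hmu ind a.
by rewrite sE; exists c.
Qed.

(** A homogeneous vector of weight [mu] and maximal degree is killed by each [x], which commutes
    with [qe mu] and raises the degree by 2. *)
Lemma highest_vector (M : gmod k beta) mu : act M (qe mu) <> 0 ->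
  exists d (v : M), [/\ v \in gcomp M d, v <> 0, qe mu # v = v & forall x, qx x # v = 0].
Proof.
move=> e0.
pose P d := exists2 u, u \in gcomp M d & qe mu # u <> 0.
have [[d [dg Pd]]|none] := pselect (exists d, d \in gsupp M /\ P d); last first.
  case: e0; apply/lfunP => u; rewrite zero_lfunE.
  have : u \in (fullv : {vspace M}) by rewrite memvf.
  rewrite -(gfull M) (big_tnth _ _ (gsupp M)) => /memv_sumP[w hw ->].
  rewrite linear_sum big1 // => i _; apply: contrapT => wi; apply: none.
  exists (tnth (in_tuple (gsupp M)) i); rewrite mem_tnth.
  by split=> //; exists (w i); rewrite ?hw.
have [{dg Pd}d [u ud eu] dmax] := seq_int_max dg Pd.
have vd : qe mu # u \in gcomp M d.
  by rewrite -[d]add0r; apply: act_gcomp => //; apply: homog_e.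
have ev : qe mu # (qe mu # u) = qe mu # u by rewrite -act_mul qeM eqxx.
exists d, (qe mu # u); split=> // x; apply: contrapT => xv.
have xd : qx x # (qe mu # u) \in gcomp M (2 + d).
  by rewrite -ev -act_mul; apply: act_gcomp => //; apply: homog_x.
have /dmax : 2 + d \in gsupp M.
  apply/negP => /negP /gsuppP h; apply: xv; apply/eqP.
  by rewrite -memv0 -h.
have -> : (2 + d <= d) = false by lia.
suff h : P (2 + d) by move=> /(_ h).
exists (qx x # (qe mu # u)) => //; rewrite -act_mul -qxe act_mul ev; exact: xv.
Qed.

Section Cyclic.
Variables (L : gmod k beta) (v : L) (d : int) (Q : R -> Prop).
Hypothesis vd : v \in gcomp L d.
Hypothesis Q0 : Q 0.
Hypothesis QL : forall (c : k) a b, Q a -> Q b -> Q (c *: a + b).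
Hypothesis QM : forall a b, Q b -> Q (a * b).
Hypothesis Qhom : forall a A s, Q a -> gdecomp a A s -> forall e, e \in s -> Q (A e).

(** [Q] is a graded left ideal and [v] is homogeneous, so the vectors [a # v] with [Q a] form a
    graded submodule of [L]. *)
Lemma cyclic_simple : simple L ->
  (forall a, Q a -> a # v = 0) \/ (forall u : L, exists2 a, Q a & u = a # v).
Proof.
move=> [_ sL].
have [||U hU] := @vspace_of_pred k L (fun u => exists2 a, Q a & u = a # v).
- by exists 0 => //; rewrite act0.
- move=> c u w [a Qa ->] [b Qb ->]; exists (c *: a + b); first exact: QL.
  by rewrite act_add act_scale.
have subU : gsubmodule U.
  split.
    move=> a; apply/subvP => w /memv_imgP[u /hU[b Qb ->] ->].
    by apply/hU; exists (a * b); [apply: QM|rewrite act_mul].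
  apply/eqP; rewrite eqEsubv; apply/andP; split; last first.
    by apply/subvP => w; rewrite (big_tnth _ _ (gsupp L)) => /memv_sumP[f hf ->];
      apply: memv_suml => i _; have := hf i isT; rewrite memv_cap => /andP[].
  apply/subvP => w /hU[a Qa ->]; have [A [s As]] := gdecomp_exists a.
  have [us hA A0 ->] := As; rewrite act_sum big_seq; apply: memv_suml => e es.
  have Ae : A e # v \in gcomp L (e + d) by apply: act_gcomp.
  have [eg|/gsuppP eg] := boolP (e + d \in gsupp L); last first.
    by move: Ae; rewrite eg memv0 => /eqP ->; apply: mem0v.
  rewrite (bigD1_seq (e + d)) ?gsupp_uniq //=.
  apply: (subvP (addvSl _ _)); rewrite memv_cap Ae andbT.
  by apply/hU; exists (A e) => //; apply: Qhom As _ es.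
have [U0|U1] := sL U subU.
  left=> a Qa; apply/eqP; rewrite -memv0 -U0; apply/hU; by exists a.
by right=> u; apply/hU; rewrite U1 memvf.
Qed.

End Cyclic.

(** Among the homogeneous components of [a], only the one of degree [d' - d] can contribute to
    [a # v]. *)
Lemma homog_act (M : gmod k beta) (v : M) d d' a : v \in gcomp M d ->
  a # v \in gcomp M d' -> exists2 b, homog (d' - d) b & a # v = b # v.
Proof.
move=> vd av; have [A [s [us hA A0 aE]]] := gdecomp_exists a.
exists (A (d' - d)) => //.
(* The degree [d' - d] is added because it may be missing from [s]. *)
pose t := undup ((d' - d) :: s).
pose u e := A (e - d) # v - (if e == d' then a # v else 0).
have hu e : u e \in gcomp M e.
  rewrite memvB //; first by rewrite -[X in gcomp M X](subrK d); apply: act_gcomp.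
  by case: eqP => [->|_] //; apply: mem0v.
have ut : uniq (map (+%R^~ d) t) by rewrite map_inj_uniq ?undup_uniq //; apply: addIr.
have dt : d' - d \in t by rewrite mem_undup inE eqxx.
have dt' : d' \in map (+%R^~ d) t by apply/mapP; exists (d' - d); rewrite ?subrK.
have u0 : \sum_(e <- map (+%R^~ d) t) u e = 0.
  rewrite sumrB big_map; under eq_bigr => e _ do rewrite addrK.
  rewrite -act_sum (big_subseq_support us (undup_uniq _) _ A0); last first.
    by move=> e es; rewrite mem_undup inE es orbT.
  rewrite -aE [X in _ - X](bigD1_seq d') //= eqxx [X in _ - (_ + X)]big1 ?addr0 ?subrr //.
  by move=> e /negbTE ->.
have := gcomp_indep ut hu u0 dt'.
by rewrite /u eqxx => /eqP; rewrite subr_eq0 => /eqP ->.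
Qed.

(** The components of [a] send [v] to distinct degrees, so the annihilator of a homogeneous vector
    is graded. *)
Lemma act_hom_eq0 (M : gmod k beta) (v : M) d a A s : v \in gcomp M d ->
  a # v = 0 -> gdecomp a A s -> forall e, e \in s -> A e # v = 0.
Proof.
move=> vd av [us hA A0 aE] e es.
have ut : uniq (map (+%R^~ d) s) by rewrite map_inj_uniq //; apply: addIr.
have hu e' : A (e' - d) # v \in gcomp M e'.
  by rewrite -[X in gcomp M X](subrK d); apply: act_gcomp.
have u0 : \sum_(e' <- map (+%R^~ d) s) A (e' - d) # v = 0.
  by rewrite big_map; under eq_bigr => e' _ do rewrite addrK; rewrite -act_sum -aE.
have := gcomp_indep ut hu u0 (map_f _ es); by rewrite addrK.
Qed.

End SimpleUnique.

Lemma word_le_cons n (x y : 'I_n) s t :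
  word_le (x :: s) (y :: t) = (x < y)%N || (x == y) && word_le s t.
Proof.
rewrite /word_le lexi_cons leEord ltn_neqAle.
rewrite -val_eqE; case: (ltngtP x y) => //=.
Qed.

Lemma word_le_refl n (s : seq 'I_n) : word_le s s.
Proof. exact: (@lexx _ (seqlexi 'I_n)). Qed.

Lemma word_le_nth n (x0 : 'I_n) (s t : seq 'I_n) i :
  (i < size s)%N -> (i < size t)%N -> (forall j, j < i -> nth x0 s j = nth x0 t j)%N ->
  (nth x0 t i < nth x0 s i)%N -> ~~ word_le s t.
Proof.
elim: i s t => [|i IH] [|x s] [|y t] //= si ti eq lt; rewrite word_le_cons.
  by rewrite negb_or -leqNgt ltnW //= negb_and -val_eqE neq_ltn lt orbT.
have -> : x = y := eq 0%N isT.
rewrite ltnn eqxx /=; apply: IH => // j ji; exact: (eq j.+1).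
Qed.

(** * A simple module is determined up to shift by its highest word *)

Section HighestUnique.
Variables (k : fieldType) (n : nat) (beta : Qplus n).
Local Notation R := (qh_alg k beta).
Local Notation m := (ht beta).
Local Notation qe := (@qe k n beta).
Local Notation qx := (@qx k n beta).
Local Notation qt := (@qt k n beta).
Local Notation "a '#' v" := (act _ a v) (at level 40).

Lemma swap_up (mu : Seq beta) c : (letter mu (lo c) < letter mu (hi c))%N ->
  ~~ word_le (val (seq_swap c mu)) (val mu).
Proof.
move=> lt; have nthE (nu : Seq beta) (x : 'I_m) : nth (letter mu (lo c)) (val nu) x
    = letter nu x.
  by rewrite /letter -tnth_nth.
have cm := ltn_ord (lo c).
apply: (@word_le_nth _ (letter mu (lo c)) _ _ (lo c)); rewrite ?size_tuple //.
- move=> j jc; have jm : (j < m)%N by apply: ltn_trans jc (ltn_ord (lo c)).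
  rewrite -[j]/(val (Ordinal jm)) !nthE /letter tnth_mktuple /sw tpermD // -val_eqE /=;
    rewrite /= in jc; lia.
by rewrite !nthE {2}/letter tnth_mktuple /sw tpermL.
Qed.

(** Moved to the left of [qt c], the idempotent becomes that of a word above the highest one, which
    acts by zero. *)
Lemma highest_raise (M : gmod k beta) (mu : Seq beta) (v : M) c :
  highest_word M (val mu) -> qe mu # v = v ->
  (letter mu (lo c) < letter mu (hi c))%N -> (qt c * qe mu) # v = 0.
Proof.
move=> [_ hw] ev lt; rewrite qte act_mul.
suff -> : act M (qe (seq_swap c mu)) = 0 by rewrite zero_lfunE.
by apply: contrapT => /hw; apply/negP/swap_up.
Qed.

(** If the annihilator of [vM] does not kill [vL], simplicity gives [a] with [a # vM = 0] and
    [a # vL = vL]. Modulo both annihilators [qe mu * a * qe mu] is one scalar times [qe mu]: on [vM]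
    the scalar is zero, on [vL] it is one. *)
Lemma highest_simple_kill (M L : gmod k beta) (mu : Seq beta) (vM : M) (vL : L) dM dL :
  highest_word M (val mu) -> highest_word L (val mu) -> simple L ->
  (forall x y : 'I_m, (x < y)%N -> letter mu x = letter mu y ->
    exists2 c : 'I_m.-1, hi c = y & (letter mu (lo c) < letter mu (hi c))%N) ->
  [/\ vM \in gcomp M dM, vM <> 0, qe mu # vM = vM & forall x, qx x # vM = 0] ->
  [/\ vL \in gcomp L dL, vL <> 0, qe mu # vL = vL & forall x, qx x # vL = 0] ->
  forall a, a # vM = 0 -> a # vL = 0.
Proof.
move=> hM hL sL hmu [vMd vM0 eM xM] [vLd vL0 eL xL].
pose Q a := a # vM = 0.
have [||||//|full] := @cyclic_simple k n beta L vL dL Q vLd _ _ _ _ sL.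
- exact: act0.
- by move=> c a b Qa Qb; rewrite /Q act_add act_scale Qa Qb scaler0 addr0.
- by move=> a b Qb; rewrite /Q act_mul Qb linear0.
- by move=> a A s Qa As; apply: act_hom_eq0 vMd Qa As.
have [a Qa aL] := full vL.
pose I b := b # vM = 0 /\ b # vL = 0.
have [|||||c [cM cL]] := @qh_corner k n beta mu I _ _ _ _ _ hmu a.
- by split; apply: act0.
- by move=> b b' [h1 h2] [h3 h4]; split; rewrite act_add ?h1 ?h2 ?h3 ?h4 addr0.
- by move=> b b' [h1 h2]; split; rewrite act_mul ?h1 ?h2 linear0.
- by move=> x; split; rewrite act_mul; [rewrite eM; exact: xM|rewrite eL; exact: xL].
- by move=> c lt; split; apply: highest_raise.
exfalso; move: cM cL; rewrite !act_sub !act_scale !act_mul eM eL -aL Qa linear0 eL sub0r.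
move=> /eqP; rewrite oppr_eq0 scaler_eq0 => /orP[/eqP ->|/eqP //].
by rewrite scale0r subr0.
Qed.

Lemma highest_simple_unique (M L : gmod k beta) (mu : Seq beta) :
  (forall x y : 'I_m, (x < y)%N -> letter mu x = letter mu y ->
    exists2 c : 'I_m.-1, hi c = y & (letter mu (lo c) < letter mu (hi c))%N) ->
  is_L (val mu) M -> is_L (val mu) L -> iso_shift M L.
Proof.
move=> hmu [sM hM] [sL hL].
have [[nu nuE hnu] _] := hM; have [[nu' nuE' hnu'] _] := hL.
have {nuE}E : nu = mu by do 2!apply: val_inj.
have {nuE'}E' : nu' = mu by do 2!apply: val_inj.
rewrite {}E in hnu; rewrite {}E' in hnu'.
have [dM [vM HM]] := highest_vector hnu; have [dL [vL HL]] := highest_vector hnu'.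
have killL := highest_simple_kill hM hL sL hmu HM HL.
have killM := highest_simple_kill hL hM sM hmu HL HM.
have [vMd vM0 eM _] := HM; have [vLd vL0 eL _] := HL.
have gen (N : gmod k beta) (v : N) d : v \in gcomp N d -> v <> 0 -> simple N ->
    forall u : N, exists a, u = a # v.
  move=> vd v0 sN; have [||||h|h u] := @cyclic_simple k n beta N v d xpredT vd _ _ _ _ sN => //.
    by case: v0; rewrite -[v]act_one; apply: h.
  by have [a _ ->] := h u; exists a.
have genM := gen M vM dM vMd vM0 sM; have genL := gen L vL dL vLd vL0 sL.
(* Any choice of [a] with [u = a # vM] gives the same value, since [killL] says that what kills [vM]
   kills [vL]. *)
pose f u := (projT1 (cid (genM u))) # vL.
have fE a : f (a # vM) = a # vL.
  rewrite /f; case: cid => b /= /eqP; rewrite eq_sym -subr_eq0 -act_sub => /eqP /killL.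
  by rewrite act_sub => /eqP; rewrite subr_eq0 => /eqP.
have flin : linear f.
  move=> c u w; have [a ->] := genM u; have [b ->] := genM w.
  by rewrite -act_scale -act_add !fE act_add act_scale.
pose F : {linear M -> L} := HB.pack f (GRing.isLinear.Build _ _ _ _ f flin).
have FE a : linfun F (a # vM) = a # vL by rewrite lfunE; exact: fE.
exists (dL - dM), (linfun F); split.
- apply/eqP; rewrite -subv0; apply/subvP => u; rewrite memv_ker.
  by have [a ->] := genM u; rewrite FE memv0 => /eqP /killM ->.
- apply/eqP; rewrite eqEsubv subvf; apply/subvP => u _.
  by have [a ->] := genL u; rewrite -FE memv_img ?memvf.
- move=> a; apply/lfunP => u; rewrite !comp_lfunE; have [b ->] := genM u.
  by rewrite -act_mul !FE act_mul.
(* By [homog_act] a homogeneous element is reached from the generating vector by a homogeneous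
   operator, so [f] shifts every degree by [dL - dM]. *)
move=> d; apply/eqP; rewrite eqEsubv; apply/andP; split; apply/subvP => u.
  move=> /memv_imgP[w wd ->]; have [a wE] := genM w.
  rewrite wE in wd *; have [b hb ->] := homog_act vMd wd; rewrite FE.
  have -> : d + (dL - dM) = (d - dM) + dL by lia.
  exact: act_gcomp.
move=> ud; have [a uE] := genL u; rewrite uE in ud *.
have [b hb ->] := homog_act vLd ud; rewrite -FE; apply: memv_img.
have -> : d = (d + (dL - dM) - dL) + dM by lia.
exact: act_gcomp.
Qed.

End HighestUnique.

(** * Minuscule representations and unipotent minors *)

Lemma q_neq0 : q != 0.
Proof. by rewrite /q tofrac_eq0 polyX_eq0. Qed.

Lemma q_sub_neq0 : q - q^-1 != 0.
Proof.
rewrite subr_eq0; apply/eqP => h.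
have : q * q = 1 by rewrite {2}h mulfV ?q_neq0.
rewrite /q -tofracM -tofrac1 => /eqP; rewrite tofrac_eq => /eqP.
move=> /(congr1 (fun p : {poly rat} => size p)).
by rewrite -expr2 size_polyXn size_poly1.
Qed.

Section States.

(* A state is a subset of [nat], the indicator of a basis vector of an exterior
   power of the vector representation, and the operators below are those of
   [U_q] on functions of states. *)
Definition state := nat -> bool.
Implicit Types (S T : state) (i j : nat).

Definition swap i S : state :=
  fun j => S (if j == i then i.+1 else if j == i.+1 then i else j).

Lemma swapL i S : swap i S i = S i.+1.
Proof. by rewrite /swap eqxx. Qed.

Lemma swapR i S : swap i S i.+1 = S i.
Proof. by rewrite /swap eqxx; case: eqP => [/esym/n_Sn|]. Qed.

Lemma swapD i S j : j != i -> j != i.+1 -> swap i S j = S j.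
Proof. by rewrite /swap => /negbTE -> /negbTE ->. Qed.

Lemma swapK i : involutive (swap i).
Proof.
move=> S; apply/funext => j.
have [->|ji] := eqVneq j i; first by rewrite swapL swapR.
have [->|ji'] := eqVneq j i.+1; first by rewrite swapR swapL.
by rewrite !swapD.
Qed.

Lemma swap_id i S : S i = S i.+1 -> swap i S = S.
Proof.
move=> e; apply/funext => j.
have [->|ji] := eqVneq j i; first by rewrite swapL.
have [->|ji'] := eqVneq j i.+1; first by rewrite swapR.
by rewrite swapD.
Qed.

Lemma swap_far i j S : (i.+1 < j)%N || (j.+1 < i)%N -> swap i (swap j S) = swap j (swap i S).
Proof. by move=> h; apply/funext => x; rewrite /swap; congr S; do !case: eqP => //; lia. Qed.

Definition vfun := state -> Qq.
Implicit Types (f g : vfun).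

(** These act on coefficient functions, so the test is on the resulting state: on basis vectors
    [opE i] moves the member [i.+1] down to [i]. *)
Definition opE i f : vfun := fun S => if S i && ~~ S i.+1 then f (swap i S) else 0.
Definition opF i f : vfun := fun S => if ~~ S i && S i.+1 then f (swap i S) else 0.

Definition delta S : vfun := fun T => (`[< T = S >])%:R.

Lemma delta_swap i S T : delta S (swap i T) = delta (swap i S) T.
Proof.
rewrite /delta; congr (_%:R); congr nat_of_bool; apply/asbool_equiv_eq; split=> [<-|->];
  by rewrite swapK.
Qed.

Lemma opE_delta i S : opE i (delta S) =
  if ~~ S i && S i.+1 then delta (swap i S) else fun=> 0.
Proof.
apply/funext => T; rewrite /opE delta_swap.
have [->|ne] := pselect (T = swap i S).
  by rewrite swapL swapR andbC; case: ifP.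
have d0 : delta (swap i S) T = 0 by rewrite /delta asboolF.
by rewrite d0 if_same; case: ifP => _; rewrite ?d0.
Qed.

Lemma opF_delta i S : opF i (delta S) =
  if S i && ~~ S i.+1 then delta (swap i S) else fun=> 0.
Proof.
apply/funext => T; rewrite /opF delta_swap.
have [->|ne] := pselect (T = swap i S).
  by rewrite swapL swapR andbC; case: ifP.
have d0 : delta (swap i S) T = 0 by rewrite /delta asboolF.
by rewrite d0 if_same; case: ifP => _; rewrite ?d0.
Qed.

Fixpoint raise_path (w : seq nat) S :=
  if w is i :: w' then [&& ~~ S i, S i.+1 & raise_path w' (swap i S)] else true.

Definition swaps (w : seq nat) S : state := foldl (fun S i => swap i S) S w.

Lemma foldl_opE w S T : foldl (fun f i => opE i f) (delta S) w T =
  (raise_path w S && `[< swaps w S = T >])%:R.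
Proof.
elim: w S => [|i w IH] S /=.
  rewrite /delta; congr (_%:R); congr nat_of_bool.
  by apply/asbool_equiv_eq; split.
rewrite opE_delta andbA; case: ifP => _ /=; first exact: IH.
have -> : foldl (fun f j => opE j f) (fun=> 0) w = (fun=> 0).
  elim: w {IH} => //= j w IHw; rewrite -[RHS]IHw; congr foldl.
  by apply/funext => T'; rewrite /opE if_same.
by [].
Qed.

Variable n : nat.

Definition wt S : weight n := [ffun i : 'I_n => (S i : nat)%:Z - (S i.+1 : nat)%:Z].

Lemma alpha_mulz (i j : 'I_n) (z : int) : (alpha i *~ z) j = cartan j i * z.
Proof.
case: z => z; rewrite /alpha ?NegzE -?pmulrn -?nmulrn ?ffunE ?ffunMnE !ffunE.
  by rewrite -mulr_natr natz.
by rewrite -mulr_natr natz mulrN.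
Qed.

Lemma reflE (i : 'I_n) lam (j : 'I_n) : refl i lam j = lam j - cartan j i * lam i.
Proof. by rewrite /refl !ffunE alpha_mulz. Qed.

Lemma wtE S (i : 'I_n) : wt S i = (S i : nat)%:Z - (S i.+1 : nat)%:Z.
Proof. by rewrite ffunE. Qed.

Lemma wt_swap (i : 'I_n) S : wt (swap i S) = refl i (wt S).
Proof.
apply/ffunP => j; rewrite reflE !wtE /cartan -val_eqE /=.
have [->|ji] := eqVneq (j : nat) i; first by rewrite swapL swapR; lia.
have [->|ji'] := eqVneq (j : nat) i.+1.
  rewrite swapR (@swapD _ _ i.+2) ?orbT; lia.
have [<-|ij] := eqVneq (j.+1) i.
  rewrite swapL swapD /=; try lia.
rewrite !swapD //=; lia.
Qed.

Lemma wt_raise (i : 'I_n) S : ~~ S i -> S i.+1 -> wt (swap i S) = wt S + alpha i.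
Proof.
move=> s0 s1; rewrite wt_swap; apply/ffunP => j.
by rewrite reflE !ffunE (negbTE s0) s1 mulrN1 opprK.
Qed.

End States.

(** * Computing the minors in a model of the fundamental representation *)

Section Minor.
Variable n : nat.
Local Notation "a '#' v" := (act _ a v) (at level 40).

Lemma pairingD h (lam mu : weight n) : pairing h (lam + mu) = pairing h lam + pairing h mu.
Proof. by rewrite /pairing -big_split; apply: eq_bigr => i _; rewrite ffunE mulrDr. Qed.

Lemma pairing_hcoroot (i : 'I_n) (lam : weight n) : pairing (hcoroot i) lam = lam i.
Proof.
rewrite /pairing (bigD1 i) //= big1 ?addr0; first by rewrite ffunE eqxx mul1r.
by move=> j ji; rewrite ffunE eq_sym (negbTE ji) mul0r.
Qed.

Lemma pairingN h (lam : weight n) : pairing (- h) lam = - pairing h lam.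
Proof. by rewrite /pairing -sumrN; apply: eq_bigr => i _; rewrite ffunE mulNr. Qed.

Lemma uK0_act (M : fdmod (@uq_rel n)) v : act M (uK 0) v = v.
Proof. by rewrite -[RHS](act_one (M := M)) -quot1; exact: (act_rel v (uq_K0 n)). Qed.

Lemma uKK_act (M : fdmod (@uq_rel n)) h v : act M (uK (- h)) (act M (uK h) v) = v.
Proof.
rewrite -[RHS]uK0_act -(addNr h) -act_quotM; exact: (act_rel v (uq_KK (- h) h)).
Qed.

Lemma uKF_act (M : fdmod (@uq_rel n)) h i v :
  act M (uK h) (act M (uF i) v) = q ^ (- pairing h (alpha i)) *: act M (uF i) (act M (uK h) v).
Proof.
have := act_rel (act M (uK h) v) (uq_KF h i).
rewrite (act_quotM (fK h * fF i) (fK (- h))) (act_quotM (fK h) (fF i)).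
move=> H; rewrite -{1}[v](uKK_act h).
exact: etrans H (act_quotZ _ (fF i) _).
Qed.

Lemma uEF_act (M : fdmod (@uq_rel n)) i j v :
  act M (uE i) (act M (uF j) v) = act M (uF j) (act M (uE i) v) +
    (if i == j then (q - q^-1)^-1 *: (act M (uK (hcoroot i)) v - act M (uK (- hcoroot i)) v)
     else 0).
Proof.
have H := etrans (esym (act_quotB (fE i * fF j) (fF j * fE i) v)) (act_rel v (uq_EF i j)).
have sub (a a' b b' c : M) : a = a' -> b = b' -> a - b = c -> a' = b' + c.
  by move=> -> -> <-; rewrite addrC subrK.
apply: etrans (sub _ _ _ _ _ (act_quotM (fE i) (fF j) v) (act_quotM (fF j) (fE i) v) H) _.
congr (_ + _); case: eqP => _.
  apply: etrans (act_quotZ _ (fK (hcoroot i) - fK (- hcoroot i)) _) _.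
  by congr (_ *: _); exact: (act_quotB (fK (hcoroot i)) (fK (- hcoroot i))).
by rewrite quot0 act0.
Qed.

Definition opK (h : coroot n) (f : vfun) : vfun := fun S => q ^ pairing h (wt n S) * f S.

(** The letter [i] stands for the vertex [i.+1], whence a set of [i.+1] members: the highest weight
    state. *)
Definition ground (i : nat) : state := fun j => (j <= i)%N.

Lemma wt_ground (i : 'I_n) : wt n (ground i) = omega i.
Proof.
apply/ffunP => j; rewrite !ffunE /ground -val_eqE /=.
by case: (ltngtP i j) => h.
Qed.

Section Model.
Variables (i0 : 'I_n) (V : hwmod (omega i0)).
Local Notation S0 := (ground i0).

(** The submodule generated by the pair of highest weight vectors inside the product of [V] and the
    functions of states. Working with this relation avoids building an isomorphism between the
    two. *)
Inductive model : V -> vfun -> Prop :=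
| ModelHw : model (hwv V) (delta S0)
| Model0 : model 0 (fun=> 0)
| ModelLin c v w f g : model v f -> model w g ->
    model (c *: v + w) (fun S => c * f S + g S)
| ModelF i v f : model v f -> model (uF i # v) (opF i f).

Lemma modelZ c v f : model v f -> model (c *: v) (fun S => c * f S).
Proof.
move=> h; have := ModelLin c h Model0; rewrite addr0.
by congr model; apply/funext => S; rewrite addr0.
Qed.

Lemma modelD v w f g : model v f -> model w g -> model (v + w) (fun S => f S + g S).
Proof.
move=> hv hw; have := ModelLin 1 hv hw; rewrite scale1r.
by congr model; apply/funext => S; rewrite mul1r.
Qed.

Lemma modelB v w f g : model v f -> model w g -> model (v - w) (fun S => f S - g S).
Proof.
move=> hv hw; have := modelD hv (modelZ (-1) hw); rewrite scaleN1r.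
by congr model; apply/funext => S; rewrite mulN1r.
Qed.

Lemma model_K h v f : model v f -> model (uK h # v) (opK h f).
Proof.
elim=> [||c {}v w {}f g _ hf _ hg|i {}v {}f hv hf].
- rewrite hwvK; have := modelZ (q ^ pairing h (omega i0)) ModelHw.
  congr model; apply/funext => S; rewrite /opK /delta.
  by case: asboolP => [->|_]; rewrite ?mulr0 // wt_ground.
- rewrite linear0; have := Model0; congr model; apply/funext => S.
  by rewrite /opK mulr0.
- rewrite linearP; have := ModelLin c hf hg.
  by congr model; apply/funext => S; rewrite /opK mulrDr mulrCA.
rewrite uKF_act; have := modelZ (q ^ (- pairing h (alpha i))) (ModelF i hf).
congr model; apply/funext => S; rewrite /opK /opF.
case: ifP => [/andP[s0 s1]|_]; last by rewrite !mulr0.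
rewrite mulrA -expfzDr ?q_neq0 // wt_raise // pairingD.
by rewrite [_ + pairing h (alpha i)]addrC addKr.
Qed.

(** The quantum integer of [e], for the only values that the weight of a state takes on a simple
    coroot. *)
Lemma q_frac (e : int) : e \in [:: -1; 0; 1] ->
  (q - q^-1)^-1 * (q ^ e - q ^ (- e)) = e%:~R.
Proof.
have h := q_sub_neq0.
rewrite !inE => /or3P[] /eqP ->.
- by rewrite opprK expr1z exprN1 -[q^-1 - q]opprB mulrN mulVf.
- by rewrite oppr0 subrr mulr0.
- by rewrite expr1z exprN1 mulVf.
Qed.

(** For adjacent indices both sides vanish, since the two moves make opposite demands on the shared
    element; distant moves commute. *)
Lemma opEF (i j : 'I_n) f : i != j -> opE i (opF j f) = opF j (opE i f).
Proof.
move=> ij; apply/funext => S; rewrite /opE /opF.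
have [e|ji] := eqVneq (j : nat) i.+1.
  by rewrite e swapR !swapL; case: (S i); case: (S i.+1); case: (S i.+2);
    rewrite /= ?andbF ?andbT.
have [e|ij'] := eqVneq (i : nat) j.+1.
  by rewrite e swapR !swapL; case: (S j); case: (S j.+1); case: (S j.+2);
    rewrite /= ?andbF ?andbT.
have ij0 : (i : nat) != j by rewrite val_eqE.
have a1 : swap i S j = S j by apply: swapD; lia.
have a2 : swap i S j.+1 = S j.+1 by apply: swapD; lia.
have b1 : swap j S i = S i by apply: swapD; lia.
have b2 : swap j S i.+1 = S i.+1 by apply: swapD; lia.
rewrite a1 a2 b1 b2 swap_far; last by lia.
by case: (S i); case: (S i.+1); case: (S j); case: (S j.+1).
Qed.

(** Induction on [model]: the ground state cannot be raised, and the case of [uF] is the commutator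
    relation, checked state by state. *)
Lemma model_E i v f : model v f -> model (uE i # v) (opE i f).
Proof.
elim=> [||c {}v w {}f g _ hf _ hg|j {}v {}f hv hf].
- rewrite hwvE opE_delta /ground; case: ifP => [|_]; last exact: Model0.
  by move=> /andP[]; lia.
- rewrite linear0; have := Model0; congr model; apply/funext => S.
  by rewrite /opE if_same.
- rewrite linearP; have := ModelLin c hf hg.
  congr model; apply/funext => S; rewrite /opE; case: ifP => _ //.
  by rewrite mulr0 addr0.
rewrite uEF_act; have [e|ij] := eqVneq i j; last first.
  by rewrite addr0 opEF //; apply: ModelF.
rewrite /=; subst j; have := modelD (ModelF i hf) (modelZ (q - q^-1)^-1
  (modelB (model_K (hcoroot i) hv) (model_K (- hcoroot i) hv))).
congr model; apply/funext => S.
rewrite /opK pairingN !pairing_hcoroot -mulrBl mulrA q_frac; last first.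
  by rewrite wtE; case: (S i); case: (S i.+1).
rewrite /opE /opF swapL swapR swapK wtE.
by case: (S i); case: (S i.+1); rewrite /= ?subrr ?mul0r ?addr0 ?add0r ?mul1r // mulN1r subrr.
Qed.

(** The form against [hwv V] kills the image of each [uF i], by adjunction with [uE i], and no [opF]
    produces the ground state. *)
Lemma model_ground v f : model v f -> Defs.form (hwv V) v = f S0.
Proof.
have form0 (w : V) : Defs.form 0 w = 0.
  have := form_lin 1 (0 : V) 0 w; rewrite scaler0 addr0 mul1r => /eqP.
  by rewrite -subr_eq0 opprD addrA subrr sub0r oppr_eq0 => /eqP.
elim=> [||c {}v w {}f g _ hf _ hg|j {}v {}f hv hf].
- by rewrite form_hwv /delta asboolT.
- by rewrite form_sym form0.
- by rewrite form_sym form_lin form_sym hf form_sym hg.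
by rewrite -formE hwvE form0 /opF /ground; case: ifP => // /andP[]; lia.
Qed.

Lemma qfact1 : qfact 1 = 1.
Proof. by rewrite /qfact big_ord1 /qint !expr1 divff ?q_sub_neq0. Qed.

Definition sw_word (w : seq 'I_n) S : state := foldr (fun i : 'I_n => swap i) S w.

Lemma weyl_wt (w : seq 'I_n) S : weyl w (wt n S) = wt n (sw_word w S).
Proof. by elim: w => //= i w ->; rewrite wt_swap. Qed.

(** The relevant coroot value is -1, 0 or 1, so each divided power is [uE i], the identity or
    [uF i], and moves the state by [swap i]. *)
Lemma model_extremal w : model (extremal V w) (delta (sw_word w S0)).
Proof.
elim: w => [|i w IH]; first exact: ModelHw.
rewrite /=; set v := extremal V w in IH *.
have -> : weyl w (omega i0) i = (sw_word w S0 i : nat)%:Z - (sw_word w S0 i.+1 : nat)%:Z.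
  by rewrite -wt_ground weyl_wt wtE.
set S := sw_word w S0 in IH *.
have [/esym e|ne] := eqVneq (S i) (S i.+1).
  rewrite e subrr /= /qfact big_ord0 invr1 scale1r expr0 act_one.
  by rewrite swap_id.
have mE := model_E i IH; have mF := ModelF i IH; move: ne mE mF.
rewrite opE_delta opF_delta.
case: (S i); case: (S i.+1) => //= _ mE mF; rewrite ?qfact1 invr1 scale1r expr1 //.
Qed.

(** The reversal in the product makes the first letter of [w] act first, as in [foldl]. *)
Lemma model_raise (w : seq 'I_n) v f : model v f ->
  Defs.form (hwv V) (act V (\prod_(i <- rev w) uE i) v) =
  foldl (fun f i => opE i f) f (map val w) S0.
Proof.
elim: w v f => [|i w IH] v f hv /=.
  by rewrite big_nil act_one; apply: model_ground.
by rewrite rev_cons -cats1 big_cat big_seq1 act_mul; apply: IH; apply: model_E.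
Qed.

Lemma minor_path (w nu : seq 'I_n) :
  minor V w (\prod_(i <- rev nu) uE i) =
  (raise_path (map val nu) (sw_word w S0) &&
   `[< swaps (map val nu) (sw_word w S0) = S0 >])%:R.
Proof. by rewrite /minor (model_raise nu (model_extremal w)) foldl_opE. Qed.

End Model.
End Minor.

(** * Vanishing of graded dimensions *)

Section GradedDim.
Variables (k : fieldType) (n : nat) (beta : Qplus n).

(** A factor [q ^ N] clears the negative exponents, and evaluation at 1 leaves a vanishing sum of
    natural numbers. *)
Lemma laurent_eq0 (s : seq int) (c : int -> nat) :
  \sum_(d <- s) (c d)%:R * q ^ d = 0 :> Qq -> forall d, d \in s -> c d = 0%N.
Proof.
move=> h.
pose N := (\sum_(d <- s) `|d|)%N.
have hN d : d \in s -> (`|d| <= N)%N.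
  by move=> ds; rewrite /N (big_rem d) //= leq_addr.
pose p : {poly rat} := \sum_(d <- s) (c d)%:R *: 'X^(absz (N%:Z + d)).
have p0 : p = 0.
  apply/eqP; rewrite -tofrac_eq tofrac0; apply/eqP.
  transitivity (q ^ N%:Z * \sum_(d <- s) (c d)%:R * q ^ d); last by rewrite h mulr0.
  rewrite /p raddf_sum mulr_sumr /= big_seq [RHS]big_seq; apply: eq_bigr => d /hN dN.
  rewrite mulrCA -expfzDr ?q_neq0 // -{2}[N%:Z + d]gez0_abs; last by lia.
  rewrite -mul_polyC tofracM -exprnP /q -tofracXn; congr (_ * _).
  by rewrite polyC_natr /= -tofracMn.
have : p.[1] = 0 by rewrite p0 horner0.
rewrite /p horner_sum.
under eq_bigr => d _ do rewrite hornerZ hornerXn expr1n mulr1.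
rewrite -natr_sum => /eqP; rewrite pnatr_eq0 => /eqP/eqP; rewrite sum_nat_seq_eq0.
by move=> /allP s0 d ds; apply/eqP; exact: s0.
Qed.

Lemma gdim_eq0 (M : gmod k beta) (nu : Seq beta) :
  gdim M nu = 0 <-> act M (qe k nu) = 0.
Proof.
split=> [h|h]; last first.
  rewrite /gdim big1 // => d _; rewrite h.
  have -> : ((0%R : 'End(M)) @: gcomp M d)%VS = 0%VS.
    by apply/eqP; rewrite -subv0; apply/subvP => u /memv_imgP[w _ ->]; rewrite zero_lfunE mem0v.
  by rewrite dimv0 mul0r.
have h0 := laurent_eq0 (c := fun d => \dim (act M (qe k nu) @: gcomp M d)) h.
apply/lfunP => u; rewrite zero_lfunE.
have : u \in (fullv : {vspace M}) by rewrite memvf.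
rewrite -(gfull M) (big_tnth _ _ (gsupp M)) => /memv_sumP[w hw ->].
rewrite linear_sum big1 // => i _; apply/eqP; rewrite -memv0.
have /eqP := h0 _ (mem_tnth i (in_tuple (gsupp M))); rewrite dimv_eq0 => /eqP <-.
by apply: memv_img; apply: hw.
Qed.

End GradedDim.

(** * The triangular array *)

Section Array.

Definition block (x y : nat) : state := fun j => (x <= j <= y)%N.
Definition holed (x y c : nat) : state := fun j => (x <= j <= y)%N && (j != c).

(** The zero-based letters of [array_word], where [e] is the row minus the column, so that every
    block has length [e.+1]. *)
Fixpoint arr (e l : nat) : seq nat :=
  if l is l'.+1 then iota l' e.+1 ++ arr e l' else [::].

Lemma arrS e l : arr e l.+1 = iota l e.+1 ++ arr e l.
Proof. by []. Qed.

Fixpoint greedy (w : seq nat) (S : state) : Prop :=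
  if w is i :: w' then
    [/\ ~~ S i, S i.+1, forall j, ~~ S j -> S j.+1 -> (j <= i)%N & greedy w' (swap i S)]
  else True.

Lemma greedy_raise w S : greedy w S -> raise_path w S.
Proof. by elim: w S => //= i w IH S [-> -> _ /IH ->]. Qed.

(** As long as the words agree they reach the same state; at the first difference the letter of [mu]
    is the largest applicable one. *)
Lemma greedy_max n (mu nu : seq 'I_n) S : greedy (map val mu) S ->
  raise_path (map val nu) S -> size nu = size mu -> word_le nu mu.
Proof.
elim: mu nu S => [|i mu IH] [|j nu] S; [by move=> *; exact: word_le_refl|by []|by []|rewrite /=].
move=> [_ _ imax g] /and3P[j0 j1 rn] [sz]; rewrite word_le_cons.
have := imax j j0 j1; rewrite leq_eqVlt => /orP[/eqP/val_inj ji|-> //].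
by rewrite ji ltnn eqxx /=; apply: IH g _ sz; rewrite -ji.
Qed.

Lemma swap_holed x y c : (x <= c < y)%N -> swap c (holed x y c) = holed x y c.+1.
Proof.
move=> h; apply/funext => j; rewrite /holed /swap.
by case: eqP => [->|ne]; [|case: eqP => [->|ne']]; lia.
Qed.

Lemma block_holed x y : block x.+1 y = holed x y x.
Proof. by apply/funext => j; rewrite /block /holed; lia. Qed.

Lemma holed_block x y : (x < y)%N -> holed x y y = block x y.-1.
Proof. by move=> h; apply/funext => j; rewrite /block /holed; lia. Qed.

(** The run pushes the hole up from [c] to [y]. The position of the hole is the largest applicable
    letter at each step. *)
Lemma greedy_run x c y d w : (x <= c)%N -> (c + d = y)%N -> greedy w (holed x y y) ->
  greedy (iota c d ++ w) (holed x y c).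
Proof.
elim: d c => [|d IH] c xc cd g; first by rewrite addn0 in cd; rewrite cd.
rewrite /=; split.
- by rewrite /holed eqxx andbF.
- by rewrite /holed; lia.
- by move=> j; rewrite /holed; lia.
by rewrite swap_holed; [apply: IH => //|]; lia.
Qed.

Lemma greedy_arr e l : greedy (arr e l) (block l (l + e)).
Proof.
elim: l => [//|l IH]; rewrite addSn block_holed.
apply: greedy_run => //; first by lia.
by rewrite holed_block //; lia.
Qed.

Lemma swaps_iota c d S j : swaps (iota c d) S j =
  if (c <= j < c + d)%N then S j.+1 else if j == (c + d)%N then S c else S j.
Proof.
elim: d => [|d IH] in c S *.
  by rewrite addn0 /=; case: ifP => [|_]; [lia|case: eqP => [->|]].
rewrite /swaps /= -/(swaps _ _) IH addSnnS.
have [->|jc] := eqVneq j c.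
  case: ifP => [|_]; first lia.
  case: eqP => [|_]; first lia.
  by rewrite swapL; case: ifP => //; lia.
case: ifP => h.
  by rewrite swapD; [case: ifP => //; lia|lia|lia].
case: eqP => [->|h'].
  by rewrite swapR; case: ifP => //; lia.
by rewrite swapD; [case: ifP => //; lia|lia|lia].
Qed.

Lemma swaps_cat v w S : swaps (v ++ w) S = swaps w (swaps v S).
Proof. exact: foldl_cat. Qed.

Lemma swaps_arr e l : swaps (arr e l) (block l (l + e)) = ground e.
Proof.
elim: l => [|l IH]; first by apply/funext => j; rewrite /block /ground add0n.
rewrite arrS swaps_cat -IH; congr swaps.
apply/funext => j; rewrite swaps_iota /block.
by case: ifP => [|h]; [lia|case: eqP => [->|]; lia].
Qed.

(* The image of [ground (r - l)] after the rounds [t.+1, ..., r] of the word of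
   the longest element. *)
Definition stage (r l t : nat) : state :=
  fun j => (j < t.+1 - l)%N || (maxn t.+1 l <= j <= r)%N.

Lemma stage_step r l t : (0 < l)%N -> (t < r)%N ->
  swaps (iota 0 t.+1) (stage r l t.+1) = stage r l t.
Proof.
move=> l0 tr; apply/funext => j; rewrite swaps_iota /stage.
by case: ifP => [|h]; [lia|case: eqP => [->|]; lia].
Qed.

(** Round [r] of the prefix is cut after [l] letters, which act before all the complete rounds. *)
Lemma stage_partial r l : (0 < l <= r)%N ->
  swaps (iota (r - l) l) (ground (r - l)) = stage r l r.-1.
Proof.
move=> h; apply/funext => j; rewrite swaps_iota /stage /ground.
by case: ifP => [|h']; [lia|case: eqP => [->|]; lia].
Qed.

Lemma stage0 r l : (0 < l)%N -> stage r l 0 = block l r.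
Proof. by move=> l0; apply/funext => j; rewrite /stage /block; lia. Qed.

Lemma iota1S t : iota 1 t.+1 = iota 1 t ++ [:: t.+1].
Proof. by rewrite -[t.+1 in LHS]addn1 iotaD add1n. Qed.

Lemma stage_rounds r l t : (0 < l)%N -> (t < r)%N ->
  foldr swap (stage r l t) (flatten [seq rev (iota 0 u) | u <- iota 1 t]) = block l r.
Proof.
move=> l0; elim: t => [|t IH] tr; first exact: stage0.
rewrite iota1S map_cat flatten_cat foldr_cat [flatten (map _ [:: _])]/= cats0.
have -> S w : foldr swap S (rev w) = swaps w S by rewrite -foldl_rev revK.
by rewrite stage_step; [apply: IH; lia|done|lia].
Qed.

(** The number of entries above row [r] of the array. *)
Definition tri r := (r * r.-1)./2.

Lemma triS r : tri r.+1 = (tri r + r)%N.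
Proof.
rewrite /tri /=; have -> : (r.+1 * r = r * r.-1 + r.*2)%N by case: r => //= r; lia.
by rewrite halfD odd_double andbF add0n doubleK.
Qed.

Lemma tri_mono r r' : (r <= r')%N -> (tri r <= tri r')%N.
Proof.
move=> /subnK <-; elim: (r' - r)%N => // d; rewrite addSn triS; lia.
Qed.

Lemma tri_uniq r l r' l' : (1 <= l <= r)%N -> (1 <= l' <= r')%N ->
  (tri r + l = tri r' + l')%N -> r = r'.
Proof.
move=> h h' e; case: (ltngtP r r') => // lt.
  by have := tri_mono lt; rewrite triS; lia.
by have := tri_mono lt; rewrite triS; lia.
Qed.

Lemma tri_exists n s : (0 < s <= tri n.+1)%N ->
  exists r l, [/\ (1 <= l <= r)%N, (r <= n)%N & s = (tri r + l)%N].
Proof.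
elim: n => [|n IH]; first by rewrite /tri; lia.
rewrite triS => h; have [le|lt] := leqP s (tri n.+1).
  by have [|r [l [h1 h2 ->]]] := IH; [lia|exists r, l; split=> //; lia].
by exists n.+1, (s - tri n.+1)%N; split; lia.
Qed.

Lemma size_rounds t : size (flatten [seq rev (iota 0 u) | u <- iota 1 t]) = tri t.+1.
Proof.
elim: t => [//|t IH]; rewrite iota1S map_cat flatten_cat size_cat IH [tri t.+2]triS.
by rewrite /= cats0 size_rev /= size_iota.
Qed.

(** Inside a block letters ascend, and the first letter of a block is smaller than all earlier ones.
    The bound by [l] lets the induction exclude the first block, whose letters are larger. *)
Lemma arr_ascent e l y : (y < size (arr e l))%N ->
  (0 < y)%N && (nth 0 (arr e l) y.-1 < nth 0 (arr e l) y)%N \/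
  nth 0%N (arr e l) y \notin take y (arr e l) /\ (nth 0 (arr e l) y < l)%N.
Proof.
elim: l y => [//|l IH] y; rewrite arrS size_cat size_iota => ys.
rewrite !nth_cat take_cat size_iota.
have [ye|ey] := ltnP y e.+1.
  have ye' : (y.-1 < e.+1)%N by lia.
  rewrite ye' !nth_iota //; case: y ys ye ye' => [|y] ys ye ye'; last by left; lia.
  by right; split=> //; lia.
have [|/andP[y0 lt]|[nin lt]] := IH (y - e.+1)%N; first lia.
  left; rewrite ifF; last lia.
  by rewrite (_ : y.-1 - e.+1 = (y - e.+1).-1)%N; lia.
right; split; last lia.
by rewrite mem_cat negb_or nin mem_iota; lia.
Qed.

End Array.

(** * Dominance and content of the array words *)

Section Words.
Variable n : nat.
Implicit Types (w mu : seq 'I_n) (l r e : nat).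

Lemma segment_val a b : (b <= n)%N -> (0 < a)%N ->
  map val (segment n a b) = iota a.-1 (b - a.-1).
Proof.
move=> bn a0.
have -> : map val (segment n a b) = [seq i <- iota 0 n | (a <= i.+1 <= b)%N].
  by rewrite -val_enum_ord filter_map.
apply: (irr_sorted_eq ltn_trans ltnn).
- by apply: sorted_filter; [exact: ltn_trans|exact: iota_ltn_sorted].
- exact: iota_ltn_sorted.
by move=> i; rewrite mem_filter !mem_iota; lia.
Qed.

Lemma array_wordS l e :
  array_word n (l.+1 + e) l.+1 = segment n l.+1 (l.+1 + e) ++ array_word n (l + e) l.
Proof.
rewrite /array_word [iota 0 l.+1]/= [map _ (_ :: _)]/= [flatten (_ :: _)]/= !subn0.
congr (_ ++ flatten _); rewrite (iotaDl 1 0) -map_comp; apply: eq_map => j /=.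
by rewrite add1n addSn !subSS.
Qed.

Lemma array_val l e : (l + e <= n)%N -> map val (array_word n (l + e) l) = arr e l.
Proof.
elim: l => [//|l IH] le; rewrite array_wordS map_cat arrS IH; last by lia.
by rewrite segment_val //; congr (iota _ _ ++ _); lia.
Qed.

Lemma segment_cons a b : (0 < a <= b)%N -> (b <= n)%N ->
  exists (x : 'I_n) t, segment n a b = x :: t /\ x.+1 = a.
Proof.
move=> ab bn; have a0 : (0 < a)%N by lia.
have := segment_val bn a0; have -> : (b - a.-1 = (b - a).+1)%N by lia.
case: (segment n a b) => [//|x t] /= [xE _].
by exists x, t; split=> //; rewrite xE prednK.
Qed.

Lemma word_lt_cons (x y : 'I_n) s t : (x < y)%N -> word_lt (x :: s) (y :: t).
Proof.
by move=> xy; rewrite /word_lt ltxi_cons !leEord (ltnW xy) leqNgt xy.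
Qed.

(** The letters increase strictly, so every proper right factor starts with a letter above the
    first. *)
Lemma segment_lyndon a b : (0 < a <= b)%N -> (b <= n)%N -> lyndon (segment n a b).
Proof.
move=> ab bn; have [x [t [E _]]] := segment_cons ab bn; split; first by rewrite E.
move=> u v; rewrite E; case: u => [//|y u] [_ tE] _; case: v tE => [//|z v] tE _.
rewrite tE; apply: word_lt_cons.
have /(congr1 (map val)) := E; rewrite segment_val; [|lia|lia].
have := iota_ltn_sorted a.-1 (b - a.-1) => + h; rewrite {}h tE /= map_cat /=.
rewrite (path_sortedE ltn_trans) => /andP[/allP h _]; apply: (h (val z)).
by rewrite mem_cat inE eqxx orbT.
Qed.

Lemma array_dominant r l : (1 <= l <= r)%N -> (r <= n)%N -> dominant (array_word n r l).
Proof.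
move=> lr rn; exists [seq segment n (l - j) (r - j) | j <- iota 0 l]; last first.
  move=> x /mapP[j]; rewrite mem_iota => jl ->.
  by exists (l - j)%N, (r - j)%N; split; [lia|split=> //; lia].
split=> //.
  by move=> x /mapP[j]; rewrite mem_iota => jl ->; apply: segment_lyndon; lia.
case: l lr => [//|l] lr; rewrite [iota _ _]/=.
(* The first letters of consecutive blocks decrease, which already decides each comparison. *)
have : forall j, (j <= l)%N -> path (fun u v : seq 'I_n => word_le v u)
   (segment n (l.+1 - j) (r - j))
   [seq segment n (l.+1 - i) (r - i) | i <- iota j.+1 (l - j)].
  move=> j jl; have [d dE] : exists d, d = (l - j)%N by exists (l - j)%N.
  rewrite -dE; elim: d j jl dE => [//|d IH] j jl dE /=.
  rewrite IH ?andbT; [|lia|lia].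
  have [||x [t [-> xE]]] := @segment_cons (l.+1 - j.+1) (r - j.+1); [lia|lia|].
  have [||y [u [-> yE]]] := @segment_cons (l.+1 - j) (r - j); [lia|lia|].
  by rewrite word_le_cons (_ : (x < y)%N = true) //; lia.
by move=> /(_ 0%N (leq0n l)); rewrite [(l - 0)%N]subn0; exact: id.
Qed.

Lemma big_content (V : nmodType) (F : 'I_n -> V) w :
  \sum_(i <- w) F i = \sum_i F i *+ content w i.
Proof.
elim: w => [|x w IH].
  by rewrite big_nil big1 // => i _; rewrite ffunE.
rewrite big_cons IH [RHS](eq_bigr (fun i => (if i == x then F i else 0) + F i *+ content w i)).
  by rewrite big_split -big_mkcond big_pred1_eq.
move=> i _; rewrite !ffunE /= eq_sym mulrnDr; congr (_ + _).
by case: eqP.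
Qed.

Lemma ht_content w : ht (content w) = size w.
Proof.
have := big_content (fun=> 1%N) w; rewrite sum1_size => ->.
by apply: eq_bigr => i _; rewrite natn.
Qed.

Lemma seq_content w : exists nu : Seq (content w), val nu = w :> seq 'I_n.
Proof.
have sz : size w == ht (content w) by rewrite ht_content.
have h : [forall i, count_mem i (Tuple sz) == content w i].
  by apply/forallP => i; rewrite ffunE.
by exists (exist _ (Tuple sz) h).
Qed.

Lemma wt_swaps w S : raise_path (map val w) S ->
  wt n (swaps (map val w) S) = wt n S + qwt (content w).
Proof.
rewrite /qwt -big_content.
elim: w S => [|i w IH] S /=; first by rewrite big_nil addr0.
move=> /and3P[s0 s1 /IH]; rewrite /swaps /= => ->.
by rewrite wt_raise // big_cons addrA.
Qed.

End Words.

(** * Matching the entry [(r, l)] with the index [s] *)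

Section Index.
Variable n : nat.

Lemma w0_val : map val (w0_seq n) = flatten [seq rev (iota 0 u) | u <- iota 1 n].
Proof.
rewrite map_flatten -map_comp; congr flatten; apply/eq_in_map => r.
rewrite mem_iota => h /=; rewrite map_rev segment_val //; last by lia.
by rewrite /= subn0.
Qed.

Lemma rnE : rn n = tri n.+1.
Proof. by rewrite /rn /tri mulnC. Qed.

Lemma w0_split r l : (1 <= l <= r)%N -> (r <= n)%N ->
  exists t, map val (w0_seq n) = (flatten [seq rev (iota 0 u) | u <- iota 1 r.-1] ++
      rev (iota (r - l) l)) ++ t.
Proof.
move=> lr rn; rewrite w0_val.
have -> : (n = r.-1 + (n - r).+1)%N by lia.
rewrite iotaD map_cat flatten_cat /= add1n prednK; last lia.
exists (rev (iota 0 (r - l)) ++ flatten [seq rev (iota 0 u) | u <- iota r.+1 (n - r)]).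
rewrite -!catA; congr (_ ++ _); rewrite catA; congr (_ ++ _).
rewrite -rev_cat -[iota (r - l) l]/(iota (0 + (r - l)) l) -iotaD.
by have -> : (r - l + l = r.-1.+1)%N by lia.
Qed.

Variables (s : 'I_(rn n)) (r l : nat).
Hypotheses (lr : (1 <= l <= r)%N) (rn_ : (r <= n)%N) (sE : s.+1 = (tri r + l)%N).

Lemma prefix_val : map val (prefix_ s) =
  flatten [seq rev (iota 0 u) | u <- iota 1 r.-1] ++ rev (iota (r - l) l).
Proof.
rewrite /prefix_ map_take; transitivity (take s.+1 (map val (w0_seq n))); first by [].
have [t E] := w0_split lr rn_; rewrite {}E take_size_cat //.
by rewrite size_cat size_rounds size_rev size_iota sE prednK //; lia.
Qed.

Lemma i_val : i_ s = (r - l)%N :> nat.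
Proof.
have ss : (s < size (prefix_ s))%N.
  by rewrite /prefix_ size_takel // size_tuple.
have -> : nat_of_ord (i_ s) = nth 0%N (map val (prefix_ s)) s.
  by rewrite (nth_map (i_ s)) // /prefix_ nth_take //; congr val; exact: tnth_nth.
rewrite prefix_val nth_cat size_rounds prednK; last by lia.
rewrite ifF; last by lia.
by rewrite nth_rev size_iota ?nth_iota; lia.
Qed.

Lemma sw_prefix : sw_word (prefix_ s) (ground (i_ s)) = block l r.
Proof.
have -> S w : sw_word w S = foldr swap S (map val w) :> state by rewrite foldr_map.
rewrite prefix_val foldr_cat i_val.
have -> S w : foldr swap S (rev w) = swaps w S by rewrite -foldl_rev revK.
by rewrite stage_partial // stage_rounds //; lia.
Qed.

Lemma lambda_wt : lambda_ s = wt n (block l r).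
Proof. by rewrite /lambda_ -wt_ground weyl_wt sw_prefix. Qed.

Lemma array_valE : map val (array_word n r l) = arr (r - l) l.
Proof. by have := @array_val n l (r - l); rewrite subnKC ?rn_; [apply|lia]. Qed.

Lemma blockE : block l r = block l (l + (r - l)).
Proof. by rewrite subnKC //; lia. Qed.

Lemma array_greedy : greedy (map val (array_word n r l)) (block l r).
Proof. by rewrite array_valE blockE; apply: greedy_arr. Qed.

Lemma array_swaps : swaps (map val (array_word n r l)) (block l r) = ground (i_ s).
Proof. by rewrite array_valE blockE i_val; apply: swaps_arr. Qed.

(** Each letter of the array word adds its simple root to the weight, on the way from the state of
    [lambda_ s] to the ground state. *)
Lemma array_qwt : qwt (content (array_word n r l)) = omega (i_ s) - lambda_ s.
Proof.
have := wt_swaps (greedy_raise array_greedy).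
by rewrite array_swaps wt_ground lambda_wt => ->; rewrite addrC addKr.
Qed.

Variable k : fieldType.
Local Notation mu := (array_word n r l).

(** The graded dimension at [nu] is 1 or 0 according to whether [nu] is a path of raising moves to
    the ground state; the greedy path is the largest. *)
Lemma is_M_is_L (V : forall i : 'I_n, hwmod (omega i)) (M : gmod k (content mu)) :
  is_M V s M -> is_L mu M.
Proof.
move=> [_ sM gd]; split=> //.
have gE (nu : Seq (content mu)) : gdim M nu =
   (raise_path (map val (val nu)) (block l r) &&
   `[< swaps (map val (val nu)) (block l r) = ground (i_ s) >])%:R.
  by rewrite gd minor_path sw_prefix.
split.
  have [nu nuE] := seq_content mu; exists nu => // /gdim_eq0; rewrite gE nuE.
  rewrite (greedy_raise array_greedy) array_swaps asboolT //.
  by move=> /eqP; rewrite oner_eq0.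
move=> nu nz; apply: (greedy_max array_greedy); last by rewrite size_tuple ht_content.
apply/negPn/negP => h; apply: nz; apply/gdim_eq0.
by rewrite gE (negbTE h).
Qed.

Lemma array_letters (nu : Seq (content mu)) : val nu = mu :> seq 'I_n ->
  forall x y : 'I_(ht (content mu)), (x < y)%N -> letter nu x = letter nu y ->
    exists2 c : 'I_(ht (content mu)).-1, hi c = y &
      (letter nu (lo c) < letter nu (hi c))%N.
Proof.
move=> nuE x y xy xyE.
have lE z : letter nu z = nth 0%N (arr (r - l) l) z :> nat.
  have valE : map val (val nu : seq 'I_n) = arr (r - l) l.
    by rewrite nuE array_valE.
  rewrite -valE (nth_map (letter nu z)) ?size_tuple //.
  by congr (nat_of_ord _); exact: tnth_nth.
have sz : size (arr (r - l) l) = ht (content mu).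
  by rewrite -array_valE size_map ht_content.
have ys : (y < size (arr (r - l) l))%N by rewrite sz.
have [/andP[y0 lt]|[nin _]] := arr_ascent ys; last first.
  case/negP: nin; rewrite -lE -xyE lE -(nth_take _ xy).
  by apply: mem_nth; rewrite size_takel // ltnW.
have ym : (y.-1 < (ht (content mu)).-1)%N by have := ltn_ord y; lia.
have hy : hi (Ordinal ym) = y by apply/val_inj => /=; lia.
by exists (Ordinal ym) => //; rewrite hy !lE.
Qed.

End Index.

Lemma bigmin_seq_le (T : eqType) (r : seq T) (P : pred T) (F : T -> nat) x j :
  j \in r -> P j -> (\big[minn/x]_(i <- r | P i) F i <= F j)%N.
Proof.
elim: r => [//|i r IH]; rewrite inE big_cons => /orP[/eqP <- ->|jr Pj].
  exact: geq_minl.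
by case: ifP => _; rewrite ?geq_min IH ?orbT.
Qed.

(** The default [rn.+1] of the minimum survives only if no later index qualifies, as those give at
    most [rn]. *)
Lemma frozenP n (s : 'I_(rn n)) :
  frozen s <-> forall t : 'I_(rn n), (s < t)%N -> i_ t <> i_ s.
Proof.
split=> [fr t st it|h].
  have : (s_plus s <= t.+1)%N.
    by apply: bigmin_seq_le; rewrite ?mem_index_enum // st it eqxx.
  by rewrite fr ltnS leqNgt ltn_ord.
rewrite /frozen /s_plus big_pred0 // => t.
by apply/negP => /andP[/h ne /eqP].
Qed.

Lemma index_exists n (s : 'I_(rn n)) :
  exists r l, [/\ (1 <= l <= r)%N, (r <= n)%N & s.+1 = (tri r + l)%N].
Proof. by apply: tri_exists; rewrite -rnE ltn_ord. Qed.

Lemma frozen_last n (s : 'I_(rn n)) r l :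
  (1 <= l <= r)%N -> (r <= n)%N -> s.+1 = (tri r + l)%N -> frozen s <-> r = n.
Proof.
move=> lr rn_ sE; split=> [/frozenP fr|rE].
  apply/eqP; rewrite eqn_leq rn_ leqNgt; apply/negP => lt.
  (* This is the zero-based index of the entry [(r.+1, l.+1)], which carries the same letter
     [r - l]. *)
  have tE : (tri r.+1 + l < rn n)%N.
    by rewrite rnE; have := tri_mono (_ : r.+2 <= n.+1)%N; rewrite triS; move/(_ lt); lia.
  have := fr (Ordinal tE); case; first by rewrite /= triS; lia.
  apply/val_inj => /=; rewrite (i_val lr rn_ sE).
  by rewrite (@i_val n (Ordinal tE) r.+1 l.+1) //=; lia.
apply/frozenP => t st it.
have [r' [l' [lr' rn' tE]]] := index_exists t.
(* A later index also lies in the last row, where distinct columns carry distinct letters. *)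
have er : r' = r.
  apply/eqP; rewrite eqn_leq {1}rE rn' leqNgt; apply/negP => lt.
  by have := tri_mono lt; rewrite triS; lia.
move/(congr1 val): it; rewrite /= (i_val lr rn_ sE) (i_val lr' rn' tE).
by rewrite er in tE lr' *; lia.
Qed.

Theorem theorem1p2 (k : fieldType) (n : nat) (hn : (0 < n)%N)
    (V : forall i : 'I_n, hwmod (omega i)) :
  (forall (r l : nat) (s : 'I_(rn n)),
     (1 <= l <= r)%N -> (r <= n)%N -> s.+1 = ((r * r.-1)./2 + l)%N ->
     let mu := array_word n r l in
     [/\ dominant mu,
         qwt (content mu) = omega (i_ s) - lambda_ s
       & forall M : gmod k (content mu), is_M V s M ->
           is_L mu M /\
           forall L : gmod k (content mu), is_L mu L -> iso_shift M L]) /\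
  (forall s : 'I_(rn n),
     frozen s <->
     exists l : nat, (1 <= l <= n)%N /\ s.+1 = ((n * n.-1)./2 + l)%N) /\
  (forall s : 'I_(rn n),
     ~ frozen s <->
     exists r l : nat, [/\ (1 <= l <= r)%N, (r <= n.-1)%N
                         & s.+1 = ((r * r.-1)./2 + l)%N]).
Proof.
split; [|split].
- move=> r l s lr rn_ sE mu; split.
  + exact: array_dominant.
  + exact: array_qwt.
  move=> M hM; have hL := is_M_is_L lr rn_ sE hM; split=> // L hL'.
  have [nu nuE] := seq_content mu.
  by apply: highest_simple_unique (array_letters lr rn_ sE nuE) _ _; rewrite nuE.
- move=> s; have [r [l [lr rn_ sE]]] := index_exists s.
  rewrite (frozen_last lr rn_ sE); split=> [rE|[l' [ln sE']]].
    by exists l; rewrite rE in lr sE.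
  by apply: (tri_uniq lr ln); rewrite -sE.
move=> s; have [r [l [lr rn_ sE]]] := index_exists s.
rewrite (frozen_last lr rn_ sE); split=> [rE|[r' [l' [lr' rn' sE']]]].
  by exists r, l; split=> //; move/eqP: rE; lia.
have -> : r = r' by apply: (tri_uniq lr lr'); rewrite -sE.
lia.
Qed.
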